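(* Let $k \ge 2$ and suppose there is an exact algorithm for MAX-NAE-$k$-SAT running in time $\mathcal{O}(c^n)$ on instances with $n$ variables. Then MAX-NAE-$k$-SAT has a $\delta$-approximation algorithm which, on a $k$-instance with $n$ variables and average clause length $\eta$, runs in time $\mathcal{O}\!\left(c^{\,n(1 - 2(1-\delta)\xi')^{1/k}}\right)$, where $\xi' = \frac{1}{2}$ for $k = 2$ and $\xi' = \frac{2^{k-1}(\eta + k - 4) - 2\eta + 4}{2^k(k-2)}$ for $k \ge 3$.
   Context: Boolean variables $v_1,\dots,v_n$; a clause is a nonempty set of literals; a $k$-instance is a set of clauses (polynomially many in $n$), each with at most $k$ literals; for NAE problems instances are assumed to have no $1$-clauses. A clause is NAE-satisfied if at least one of its literals is true and at least one is false. MAX-NAE-$k$-SAT: given a $k$-instance, find an assignment maximizing the number of NAE-satisfied clauses; an exact algorithm outputs such an optimal assignment. A $\delta$-approximation algorithm outputs an assignment NAE-satisfying at least $\delta$ times the optimum number of clauses. If the instance has $m_i$ clauses with exactly $i$ literals, its average clause length is $\eta = (\sum_i i\, m_i)/\sum_i m_i$. $\mathcal{O}(T(n))$ denotes $2^{o(n)} T(n)$. *)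

(* Defs.v *)
From HB Require Import structures.
From mathcomp Require Import all_boot all_order all_algebra.
From mathcomp Require Import all_classical all_reals all_analysis.
Import Order.TTheory GRing.Theory Num.Theory.
Import numFieldNormedType.Exports.

Set Implicit Arguments.
Unset Strict Implicit.
Unset Printing Implicit Defensive.

Local Open Scope ring_scope.

(** * NAE satisfiability *)

Section NAE.
Variable n : nat.

(* (i, true) is the literal v_i and (i, false) is its negation. *)
Definition literal := ('I_n * bool)%type.
Definition clause := {set literal}.
Definition instance := {set clause}.
Definition assignment := {ffun 'I_n -> bool}.

Definition lit_true (a : assignment) (l : literal) : bool := a l.1 == l.2.

Definition nae_sat (a : assignment) (C : clause) : bool :=
  [exists l in C, lit_true a l] && [exists l in C, ~~ lit_true a l].

(* Clauses are nonempty and NAE instances have no 1-clause, hence the lower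
   bound 2.  For fixed k such a set has at most (2n+1)^k elements, so the number
   of clauses is polynomial in n without further assumption.  A clause may
   contain a variable together with its negation. *)
Definition k_instance (k : nat) (I : instance) : Prop :=
  forall C : clause, C \in I -> (2 <= #|C| <= k)%N.

Definition nae_value (I : instance) (a : assignment) : nat :=
  #|[set C in I | nae_sat a C]|.

Definition nae_opt (I : instance) : nat :=
  \max_(a : assignment) nae_value I a.

Definition num_clauses (I : instance) (i : nat) : nat :=
  #|[set C in I | #|C| == i]|.

(* Average clause length of a k-instance (0 for the empty instance). *)
Definition avg_length (R : realType) (k : nat) (I : instance) : R :=
  (\sum_(i < k.+1) i * num_clauses I i)%N%:R /
  (\sum_(i < k.+1) num_clauses I i)%N%:R.

End NAE.

(** * Model of computation *)

(* Programs are a one-variable, point-free form of Jones's WHILE language over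
   binary trees, with unit cost per executed instruction.  Trees are handled by
   reference, so that copying a tree and forming a node take constant time.
   A random access machine executes a step with constant overhead, and
   conversely a RAM running in time T is simulated with overhead polynomial in
   log T by keeping its memory in a balanced tree.  Hence for running times
   2^(O(n)) the two models agree up to a factor polynomial in n, which 2^(o(n))
   absorbs. *)

Inductive tree := Leaf | Node of tree & tree.

Definition left_subtree (x : tree) := if x is Node l _ then l else Leaf.
Definition right_subtree (x : tree) := if x is Node _ r then r else Leaf.

Inductive prog :=
  | PId
  | PLeaf
  | PLeft
  | PRight
  | PNode of prog & prog
  | PSeq of prog & prog
  | PIf of prog & prog & prog
  | PWhile of prog & prog.

(* [run p x y t]: on input x, program p halts with output y after t steps.
   A test succeeds when its value is not [Leaf]. *)
Inductive run : prog -> tree -> tree -> nat -> Prop :=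
  | RunId x : run PId x x 1
  | RunLeaf x : run PLeaf x Leaf 1
  | RunLeft x : run PLeft x (left_subtree x) 1
  | RunRight x : run PRight x (right_subtree x) 1
  | RunNode p q x y z s t :
      run p x y s -> run q x z t -> run (PNode p q) x (Node y z) (s + t).+1
  | RunSeq p q x y z s t :
      run p x y s -> run q y z t -> run (PSeq p q) x z (s + t).+1
  | RunIfTrue b p q x l r y s t :
      run b x (Node l r) s -> run p x y t -> run (PIf b p q) x y (s + t).+1
  | RunIfFalse b p q x y s t :
      run b x Leaf s -> run q x y t -> run (PIf b p q) x y (s + t).+1
  | RunWhileStop b p x s :
      run b x Leaf s -> run (PWhile b p) x x s.+1
  | RunWhileStep b p x l r y z s t u :
      run b x (Node l r) s -> run p x y t -> run (PWhile b p) y z u ->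
      run (PWhile b p) x z (s + t + u).+1.

(** * Encodings *)

Definition enc_nat (m : nat) : tree := iter m (Node Leaf) Leaf.

Definition enc_bool (b : bool) : tree := if b then Node Leaf Leaf else Leaf.

Definition enc_seq (T : Type) (enc : T -> tree) (s : seq T) : tree :=
  foldr (fun u acc => Node (enc u) acc) Leaf s.

Definition enc_literal n (l : literal n) : tree :=
  Node (enc_bool l.2) (enc_nat l.1).

Definition enc_assignment n (a : assignment n) : tree :=
  enc_seq enc_bool [seq a i | i <- enum 'I_n].

(* An instance may be presented by listing its clauses, and the literals of each
   clause, in any order but without repetition. *)
Definition encodes n (I : instance n) (x : tree) : Prop :=
  exists s : seq (seq (literal n)),
    [/\ forall C, C \in s -> uniq C,
        uniq [seq [set l in C] | C <- s],
        I = [set D in [seq [set l in C] | C <- s]]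
      & x = Node (enc_nat n) (enc_seq (enc_seq (@enc_literal n)) s)].

(** * Algorithms for MAX-NAE-k-SAT *)

(* [nae_algorithm k good T p]: on every k-instance I with n variables, p outputs
   an assignment satisfying [good I] within time 2^(o(n)) * T I.  The o(n) term
   depends on n alone and not on the instance. *)
Definition nae_algorithm (R : realType) (k : nat)
    (good : forall n, instance n -> assignment n -> Prop)
    (T : forall n, instance n -> R) (p : prog) : Prop :=
  exists f : nat -> R,
    (f =o_\oo (fun n => n%:R : R))%classic /\
    forall (n : nat) (I : instance n) (x : tree),
      k_instance k I -> encodes I x ->
      exists (a : assignment n) (t : nat),
        [/\ run p x (enc_assignment a) t,
            good n I a
          & t%:R <= 2 `^ (f n) * T n I].

Definition optimal n (I : instance n) (a : assignment n) : Prop :=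
  nae_value I a = nae_opt I.

Definition approximate (R : realType) (delta : R) n
    (I : instance n) (a : assignment n) : Prop :=
  delta * (nae_opt I)%:R <= (nae_value I a)%:R.

Definition xi' (R : realType) (k : nat) (eta : R) : R :=
  if k == 2%N then 2^-1
  else (2 ^+ k.-1 * (eta + k%:R - 4) - 2 * eta + 4) / (2 ^+ k * (k%:R - 2)).

(* The radicand can be negative only when delta < 1/2; it is then read as 0. *)
Definition exponent (R : realType) (k : nat) (delta eta : R) (n : nat) : R :=
  n%:R * Num.max 0 (1 - 2 * (1 - delta) * xi' k eta) `^ (k%:R^-1).

(* Main.v *)
(* The algorithm deletes variables one at a time, each time the one occurring in
   the fewest remaining clauses, solves the clauses that survive exactly, and
   then gives values to the deleted variables greedily.  A clause all of whose
   variables but one have values is NAE-satisfied by at least one value of the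
   last variable, so half of the [r] lost clauses are recovered: the result is
   at least [OPT_S + r/2], whereas [OPT <= OPT_S + r].  This is a
   [delta]-approximation as soon as [(delta - 1/2) r <= (1 - delta) OPT_S].
   Deleting down to [s] of the [n] variables keeps a fraction of at least
   [s (s-1) ... (s-k+1) / (n (n-1) ... (n-k+1))] of the clauses, about
   [(s/n)^k], and this yields the exponent.

   The number [delta] need not be computable, so the program cannot compare with
   it.  A random assignment shows [OPT_S >= W_S], the sum over the surviving
   clauses [C] of [1 - 2^(1-|C|)], and the program tests
   [(delta - 1/2) r <= (1 - delta) W_S] with integer approximations of the
   coefficients.  The rounding is harmless because the test has slack: the [r]
   lost clauses contribute at most [(1 - 2^(1-k)) r] to the sum over all
   clauses, so [W_S + r >= xi' m + 2^(1-k) r] for [m] clauses in total. *)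
Require Import Defs.
From mathcomp Require Import all_boot all_order all_algebra.
From mathcomp Require Import all_classical all_reals all_analysis.
From mathcomp Require Import zify lra.
Import Order.TTheory GRing.Theory Num.Theory.
Import numFieldNormedType.Exports.

Set Implicit Arguments.
Unset Strict Implicit.
Unset Printing Implicit Defensive.

(** * Polynomial-time functions on encoded types *)

Class encoding (A : Type) := enc : A -> tree.

#[export] Instance encoding_unit : encoding unit := fun=> Leaf.
#[export] Instance encoding_bool : encoding bool := enc_bool.
#[export] Instance encoding_nat : encoding nat := enc_nat.
#[export] Instance encoding_prod A B {eA : encoding A} {eB : encoding B} :
  encoding (A * B) := fun z => Node (enc z.1) (enc z.2).
#[export] Instance encoding_seq A {eA : encoding A} : encoding (seq A) :=
  enc_seq enc.

Fixpoint tsize (x : tree) : nat :=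
  if x is Node l r then (tsize l + tsize r).+1 else 1.

Section Polynomial.
Context {X : Type} {eX : encoding X}.

Definition esize (x : X) := tsize (enc x).

(** The base is at least 2, so a larger exponent [d] absorbs constants, coefficients and sums. *)
Definition pbound (h : X -> nat) :=
  exists d, forall x, h x <= (esize x).+1 ^ d.

Lemma esize_gt0 x : 0 < esize x.
Proof. by rewrite /esize; move: (enc x) => -[]. Qed.

Lemma pbound_le h g : (forall x, h x <= g x) -> pbound g -> pbound h.
Proof. by move=> hg [d gd]; exists d => x; exact: leq_trans (hg x) (gd x). Qed.

Lemma pbound_const c : pbound (fun=> c).
Proof.
exists c => x; apply: leq_trans (ltnW (ltn_expl c (ltnSn 1))) _.
by case: c => // c; rewrite leq_exp2r ?ltnS ?esize_gt0.
Qed.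

Lemma pbound_size : pbound esize.
Proof. by exists 1 => x; rewrite expn1. Qed.

Lemma pboundM h g : pbound h -> pbound g -> pbound (fun x => h x * g x).
Proof.
by case=> d hd [e ge]; exists (d + e) => x; rewrite expnD leq_mul.
Qed.

Lemma pboundD h g : pbound h -> pbound g -> pbound (fun x => h x + g x).
Proof.
case=> d hd [e ge]; exists (maxn d e).+1 => x.
rewrite expnS; have B : 1 < (esize x).+1 by rewrite ltnS esize_gt0.
have h1 : h x <= (esize x).+1 ^ maxn d e.
  by apply: leq_trans (hd x) _; rewrite leq_exp2l // leq_maxl.
have h2 : g x <= (esize x).+1 ^ maxn d e.
  by apply: leq_trans (ge x) _; rewrite leq_exp2l // leq_maxr.
apply: leq_trans (leq_add h1 h2) _.
by rewrite addnn -mul2n leq_mul2r ltnS esize_gt0 orbT.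
Qed.

Lemma pboundX h e : pbound h -> pbound (fun x => h x ^ e).
Proof.
case=> d hd; exists (d * e) => x; rewrite expnM.
by case: e => // e; rewrite leq_exp2r.
Qed.

Lemma pboundS h : pbound h -> pbound (fun x => (h x).+1).
Proof.
move=> hh; apply: pbound_le (pboundD (pbound_const 1) hh) => x.
by rewrite add1n.
Qed.

End Polynomial.

Lemma esize_pair A B {eA : encoding A} {eB : encoding B} (a : A) (b : B) :
  esize (a, b) = (esize a + esize b).+1.
Proof. by []. Qed.

Lemma esize_cons A {eA : encoding A} (a : A) (s : seq A) :
  esize (a :: s) = (esize a + esize s).+1.
Proof. by []. Qed.

Lemma pbound_comp X Y {eX : encoding X} {eY : encoding Y} (f : X -> Y) h :
  pbound (fun x => esize (f x)) -> pbound h -> pbound (fun x => h (f x)).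
Proof.
move=> hf [d hd]; apply: pbound_le (fun x => hd (f x)) _.
exact/pboundX/pboundS.
Qed.

Section Computable.
Context {X Y : Type} {eX : encoding X} {eY : encoding Y}.

Definition computes (p : prog) (f : X -> Y) (T : X -> nat) :=
  forall x, exists2 t, run p (enc x) (enc (f x)) t & t <= T x.

(** The size of the value is bounded separately from the time: subtrees are shared, so repeating
    [PNode PId PId] builds trees of size exponential in the number of steps, and the time of the
    next program in a composition is measured in that size. *)
Definition polytime (f : X -> Y) :=
  pbound (fun x => esize (f x)) /\ exists p T, pbound T /\ computes p f T.

Lemma polytime_ext (f g : X -> Y) : f =1 g -> polytime f -> polytime g.
Proof.
move=> fg [sf [p [T [bT cT]]]]; split.
  by apply: pbound_le sf => x; rewrite fg.
by exists p, T; split=> // x; rewrite -fg.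
Qed.

End Computable.

Lemma polytime_comp X Y Z {eX : encoding X} {eY : encoding Y} {eZ : encoding Z}
    (g : Y -> Z) (f : X -> Y) :
  polytime g -> polytime f -> polytime (fun x => g (f x)).
Proof.
case=> sg [q [U [bU cU]]] [sf [p [T [bT cT]]]]; split.
  exact: (pbound_comp sf sg).
exists (PSeq p q), (fun x => (T x + U (f x)).+1); split.
  by apply/pboundS/pboundD => //; apply: (pbound_comp sf bU).
move=> x; have [s rs sT] := cT x; have [t rt tU] := cU (f x).
exists (s + t).+1; first exact: RunSeq rs rt.
by rewrite ltnS leq_add.
Qed.

Lemma polytime_step X Y {eX : encoding X} {eY : encoding Y} (f : X -> Y) p :
  pbound (fun x => esize (f x)) ->
  (forall x, run p (enc x) (enc (f x)) 1) -> polytime f.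
Proof.
move=> sf rp; split=> //; exists p, (fun=> 1); split; first exact: pbound_const.
by move=> x; exists 1.
Qed.

Section Basic.
Context {X : Type} {eX : encoding X}.

Lemma polytime_id : polytime (fun x : X => x).
Proof. by apply: (polytime_step (p := PId)) pbound_size _ => x; constructor. Qed.

Lemma polytime_pair Y Z {eY : encoding Y} {eZ : encoding Z}
    (f : X -> Y) (g : X -> Z) :
  polytime f -> polytime g -> polytime (fun x => (f x, g x)).
Proof.
case=> sf [p [T [bT cT]]] [sg [q [U [bU cU]]]]; split.
  exact: (pboundS (pboundD sf sg)).
exists (PNode p q), (fun x => (T x + U x).+1); split.
  exact/pboundS/pboundD.
move=> x; have [s rs sT] := cT x; have [t rt tU] := cU x.
exists (s + t).+1; first exact: RunNode rs rt.
by rewrite ltnS leq_add.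
Qed.

Lemma polytime_fst Y Z {eY : encoding Y} {eZ : encoding Z} (f : X -> Y * Z) :
  polytime f -> polytime (fun x => (f x).1).
Proof.
apply: polytime_comp; apply: (polytime_step (p := PLeft)).
  by apply: pbound_le pbound_size => -[y z]; rewrite esize_pair /=; lia.
by move=> [y z]; apply: RunLeft.
Qed.

Lemma polytime_snd Y Z {eY : encoding Y} {eZ : encoding Z} (f : X -> Y * Z) :
  polytime f -> polytime (fun x => (f x).2).
Proof.
apply: polytime_comp; apply: (polytime_step (p := PRight)).
  by apply: pbound_le pbound_size => -[y z]; rewrite esize_pair /=; lia.
by move=> [y z]; apply: RunRight.
Qed.

Lemma polytime_const Y {eY : encoding Y} (y : Y) : polytime (fun _ : X => y).
Proof.
split; first exact: pbound_const.
have build u : exists p t, forall x, run p x u t.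
  elim: u => [|l [p [s ps]] r [q [t qt]]].
    by exists PLeaf, 1 => x; constructor.
  by exists (PNode p q), (s + t).+1 => x; constructor.
have [p [t pt]] := build (enc y).
by exists p, (fun=> t); split; [exact: pbound_const | move=> x; exists t].
Qed.

Lemma polytime_if Y {eY : encoding Y} (b : X -> bool) (f g : X -> Y) :
  polytime b -> polytime f -> polytime g -> polytime (fun x => if b x then f x else g x).
Proof.
case=> _ [r [V [bV cV]]] [sf [p [T [bT cT]]]] [sg [q [U [bU cU]]]]; split.
  by apply: pbound_le (pboundD sf sg) => x; case: (b x); rewrite ?leq_addl ?leq_addr.
exists (PIf r p q), (fun x => (V x + (T x + U x)).+1); split.
  exact/pboundS/pboundD/pboundD.
move=> x; have [u ru uV] := cV x; have [s rs sT] := cT x.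
have [t rt tU] := cU x; case: (b x) ru => ru.
  exists (u + s).+1; first exact: RunIfTrue ru rs.
  by rewrite ltnS leq_add // (leq_trans sT) ?leq_addr.
exists (u + t).+1; first exact: RunIfFalse ru rt.
by rewrite ltnS leq_add // (leq_trans tU) ?leq_addl.
Qed.

Lemma polytime_cons A {eA : encoding A} (a : X -> A) (l : X -> seq A) :
  polytime a -> polytime l -> polytime (fun x => a x :: l x).
Proof.
move=> ca cl; apply: (@polytime_comp _ _ _ _ _ _ (fun z : A * seq A => z.1 :: z.2)
  (fun x => (a x, l x))); last exact: polytime_pair.
apply: (polytime_step (p := PId)); last by move=> x; apply: RunId.
exact: pbound_size.
Qed.

Lemma polytime_behead A {eA : encoding A} (l : X -> seq A) :
  polytime l -> polytime (fun x => behead (l x)).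
Proof.
apply: polytime_comp; apply: (polytime_step (p := PRight)); last first.
  by move=> x; rewrite (_ : enc (behead x) = right_subtree (enc x));
     [apply: RunRight | case: x].
by apply: pbound_le pbound_size => -[|y z] //; rewrite esize_cons /=; lia.
Qed.

(* The default value is the one encoded by [Leaf], the left subtree of [Leaf]. *)
Lemma polytime_head A {eA : encoding A} (a0 : A) (l : X -> seq A) :
  enc a0 = Leaf -> polytime l -> polytime (fun x => head a0 (l x)).
Proof.
move=> a0E; apply: polytime_comp; apply: (polytime_step (p := PLeft)); last first.
  by move=> x; rewrite (_ : enc (head a0 x) = left_subtree (enc x));
     [apply: RunLeft | case: x].
apply: pbound_le pbound_size => -[|y z]; rewrite ?esize_cons /=; last by lia.
by rewrite /esize a0E.
Qed.

Lemma polytime_succn (m : X -> nat) : polytime m -> polytime (fun x => (m x).+1).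
Proof.
apply: polytime_comp; split; last first.
  exists (PNode PLeaf PId), (fun=> 3); split; first exact: pbound_const.
  by move=> n; exists 3 => //; apply: (@RunNode _ _ _ _ _ 1 1); constructor.
apply: pbound_le (pboundD (pbound_const 2) pbound_size) => n.
by rewrite /esize /= /enc /encoding_nat /=; lia.
Qed.

(** Since [tt] is encoded by [Leaf], a unary numeral and a list of that many units are the same
    tree. This lets numbers drive loops over lists. *)
Lemma polytime_units (m : X -> nat) : polytime m -> polytime (fun x => nseq (m x) tt).
Proof.
have E n : enc (nseq n tt) = enc n by elim: n => //= n IHn; rewrite -[RHS]/(Node Leaf (enc n)) -IHn.
apply: polytime_comp; apply: (polytime_step (p := PId)).
  by apply: pbound_le pbound_size => n; rewrite /esize E.
by move=> n; rewrite E; constructor.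
Qed.

(* The loop runs on the stores [Node rest (Node x acc)]. *)
Lemma polytime_foldl A B {eA : encoding A} {eB : encoding B}
    (l : X -> seq A) (b : X -> B) (g : X -> B -> A -> B) :
  polytime l -> polytime b -> polytime (fun z : X * B * A => g z.1.1 z.1.2 z.2) ->
  (exists2 H, pbound H &
     forall x s t, l x = s ++ t -> esize (foldl (g x) (b x) s) <= H x) ->
  polytime (fun x => foldl (g x) (b x) (l x)).
Proof.
move=> [sl [p [T [bT cT]]]] [sb [q [U [bU cU]]]] [_ [r [V [[d dV] cV]]]] [H bH leH].
split; first by apply: pbound_le bH => x; apply: (leH x _ [::]); rewrite cats0.
pose body := PNode (PSeq PLeft PRight)
  (PNode (PSeq PRight PLeft) (PSeq (PNode PRight (PSeq PLeft PLeft)) r)).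
(* Bounds one call of [r]: its argument consists of [x], an accumulator of size at most [H x] and an
   element of [l x]. The 3 covers the two pairing nodes and the successor in [pbound]. *)
pose W x := (esize (eX := eX) x + H x + esize (eX := @encoding_seq _ eA) (l x)).+3 ^ d.
have bW : pbound W.
  exact/pboundX/pboundS/pboundS/pboundS/(pboundD (pboundD pbound_size bH) sl).
have loop x s u : l x = u ++ s -> exists2 t,
    run (PWhile PLeft body) (Node (enc s) (Node (enc x) (enc (foldl (g x) (b x) u))))
      (Node Leaf (Node (enc x) (enc (foldl (g x) (b x) (l x))))) t
    & t <= size s * (W x + 20) + 2.
  elim: s u => [|a s IHs] u lE.
    exists 2; last by lia.
    by rewrite lE cats0; apply: RunWhileStop; exact: RunLeft.
  have [|t rt tW] := IHs (rcons u a); first by rewrite cat_rcons.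
  rewrite foldl_rcons in rt; set c := foldl _ _ u in rt *.
  have [v rv vV] := cV (x, c, a).
  have vW : v <= W x.
    apply: leq_trans vV (leq_trans (dV _) _); rewrite /W !esize_pair.
    have := leH x u _ lE; rewrite -/c.
    have : esize a <= esize (l x).
      by rewrite lE; elim: (u) => [|y w IHw] /=; rewrite esize_cons; lia.
    case: (d) => // d'; rewrite leq_exp2r //; lia.
  eexists; first apply: (RunWhileStep (p := body)).
  - exact: RunLeft.
  - apply: RunNode; first by apply: RunSeq; [exact: RunLeft | exact: RunRight].
    apply: RunNode; first by apply: RunSeq; [exact: RunRight | exact: RunLeft].
    apply: RunSeq rv; apply: RunNode; first exact: RunRight.
    by apply: RunSeq; exact: RunLeft.
  - exact: rt.
  - by rewrite /=; lia.
exists (PSeq (PNode p (PNode PId q)) (PSeq (PWhile PLeft body) (PSeq PRight PRight))).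
exists (fun x => T x + U x + esize (l x) * (W x + 20) + 20); split.
  apply: pboundD (pbound_const _); apply: pboundD; first exact: pboundD.
  by apply: pboundM => //; apply: pboundD (pbound_const _).
move=> x; have [t1 r1 h1] := cT x; have [t2 r2 h2] := cU x.
have [t3 r3 h3] := loop x (l x) [::] erefl.
eexists.
  apply: RunSeq; first by apply: RunNode r1 (RunNode (RunId _) r2).
  apply: RunSeq; first exact: r3.
  by apply: RunSeq; exact: RunRight.
have : size (l x) <= esize (l x).
  by elim: (l x) => // y w IHw; rewrite esize_cons /=; lia.
by move=> hs; have := leq_mul hs (leqnn (W x + 20)); lia.
Qed.

End Basic.

Lemma esize_nat (n : nat) : esize n = n.*2.+1.
Proof. by elim: n => // n IHn; rewrite -[LHS]/(esize n).+2 IHn doubleS. Qed.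

Lemma esize_bool (b : bool) : esize b <= 3.
Proof. by case: b. Qed.

Lemma esize_seq A {eA : encoding A} M (s : seq A) :
  all (fun a => esize a <= M) s -> esize s <= (size s * M.+1).+1.
Proof.
by elim: s => // a s IHs /= /andP[aM /IHs sM]; rewrite esize_cons; lia.
Qed.

Lemma size_esize A {eA : encoding A} (s : seq A) : size s <= esize s.
Proof. by elim: s => // a s IHs; rewrite esize_cons /=; lia. Qed.

Lemma esize_filter A {eA : encoding A} (P : pred A) (s : seq A) :
  esize [seq a <- s | P a] <= esize s.
Proof. by elim: s => //= a s IHs; case: (P a); rewrite !esize_cons; lia. Qed.

Lemma foldl_units A B (f : A -> A) (a : A) (s : seq B) :
  foldl (fun a _ => f a) a s = iter (size s) f a.
Proof. by elim: s a => //= b s IHs a; rewrite IHs -iterSr. Qed.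

(** * List operations and unary arithmetic in polynomial time *)

Section Lists.
Context {X : Type} {eX : encoding X}.

(** An additive increase per element keeps the accumulator polynomial, since the list has at most
    [esize (l x)] elements; a constant factor per step would already allow exponential growth. *)
Lemma polytime_foldl_add A B {eA : encoding A} {eB : encoding B}
    (l : X -> seq A) (b : X -> B) (g : X -> B -> A -> B) (h : X -> nat) :
  polytime l -> polytime b -> polytime (fun z : X * B * A => g z.1.1 z.1.2 z.2) ->
  pbound h ->
  (forall x c a, esize a <= esize (l x) -> esize (g x c a) <= esize c + h x) ->
  polytime (fun x => foldl (g x) (b x) (l x)).
Proof.
move=> cl cb cg bh gh; apply: polytime_foldl => //.
exists (fun x => esize (b x) + esize (l x) * h x).
  by apply: pboundD; [case: cb | apply: pboundM => //; case: cl].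
move=> x s t lE; have : all (fun a => esize a <= esize (l x)) s.
  rewrite lE; elim: s {lE} => //= a s IHs; rewrite esize_cons; apply/andP; split.
    by lia.
  by apply: sub_all IHs => a'; lia.
have sl : size s <= esize (l x) by rewrite (leq_trans _ (size_esize _)) // lE size_cat leq_addr.
move=> sx; apply: leq_trans (_ : esize (b x) + size s * h x <= _); last first.
  by rewrite leq_add2l leq_mul2r sl orbT.
elim/last_ind: s {lE sl} sx => [|s a IHs]; first by rewrite addn0.
rewrite all_rcons foldl_rcons size_rcons => /andP[ax /IHs sx].
by apply: leq_trans (gh _ _ _ ax) _; rewrite mulSn; lia.
Qed.

Lemma polytime_rev A {eA : encoding A} (l : X -> seq A) :
  polytime l -> polytime (fun x => rev (l x)).
Proof.
move=> cl; apply: (polytime_ext (f := fun x => foldl (fun c a => a :: c) [::] (l x))).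
  by move=> x; rewrite /rev; elim: (l x) [::] => //=.
apply: (polytime_foldl_add (h := fun x => (esize (l x)).+1)) => //.
- exact: polytime_const.
- apply: polytime_cons; first exact/polytime_snd/polytime_id.
  exact/polytime_snd/polytime_fst/polytime_id.
- by apply: pboundS; case: cl.
by move=> x c a al; rewrite esize_cons; lia.
Qed.

Lemma polytime_foldr A B {eA : encoding A} {eB : encoding B}
    (l : X -> seq A) (b : X -> B) (g : X -> A -> B -> B) (h : X -> nat) :
  polytime l -> polytime b -> polytime (fun z : X * B * A => g z.1.1 z.2 z.1.2) ->
  pbound h ->
  (forall x c a, esize a <= esize (l x) -> esize (g x a c) <= esize c + h x) ->
  polytime (fun x => foldr (g x) (b x) (l x)).
Proof.
move=> cl cb cg bh gh.
apply: (polytime_ext (f := fun x => foldl (fun c a => g x a c) (b x) (rev (l x)))).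
  by move=> x; rewrite foldl_rev.
have esize_rev x : esize (rev (l x)) = esize (l x).
  elim: (l x) => // a s IHs; rewrite rev_cons esize_cons -IHs.
  by elim: (rev s) => [|a' s' IHs'] /=; rewrite !esize_cons ?IHs'; lia.
apply: (@polytime_foldl_add _ _ _ _ _ _ (fun x c a => g x a c) h) => //; first exact: polytime_rev.
by move=> x c a; rewrite esize_rev; exact: gh.
Qed.

Lemma polytime_map A B {eA : encoding A} {eB : encoding B}
    (l : X -> seq A) (f : X -> A -> B) :
  polytime l -> polytime (fun z : X * A => f z.1 z.2) ->
  polytime (fun x => [seq f x a | a <- l x]).
Proof.
move=> cl cf; have [[d fd] _] := cf.
apply: (polytime_foldr (g := fun x a c => f x a :: c)
  (h := fun x => ((esize x + esize (l x)).+2 ^ d).+1)) => //.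
- exact: polytime_const.
- apply: polytime_cons; last exact/polytime_snd/polytime_fst/polytime_id.
  apply: (polytime_comp (f := fun z : X * seq B * A => (z.1.1, z.2)) cf).
  by apply: polytime_pair; [apply/polytime_fst/polytime_fst/polytime_id | apply/polytime_snd/polytime_id].
- by apply/pboundS/pboundX/pboundS/pboundS/(pboundD pbound_size); case: cl.
move=> x c a al; rewrite esize_cons.
have : esize (f x a) <= (esize x + esize (l x)).+2 ^ d.
  apply: leq_trans (fd (x, a)) _; rewrite esize_pair.
  by case: (d) => // d'; rewrite leq_exp2r //; lia.
lia.
Qed.

Lemma polytime_filter A {eA : encoding A} (l : X -> seq A) (P : X -> pred A) :
  polytime l -> polytime (fun z : X * A => P z.1 z.2) ->
  polytime (fun x => [seq a <- l x | P x a]).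
Proof.
move=> cl cP.
apply: (polytime_foldr (g := fun x a c => if P x a then a :: c else c)
  (h := fun x => (esize (l x)).+1)) => //.
- exact: polytime_const.
- apply: polytime_if.
  + apply: (polytime_comp (f := fun z : X * seq A * A => (z.1.1, z.2)) cP).
    by apply: polytime_pair; [apply/polytime_fst/polytime_fst/polytime_id | apply/polytime_snd/polytime_id].
  + by apply: polytime_cons; [apply/polytime_snd/polytime_id | apply/polytime_snd/polytime_fst/polytime_id].
  + exact/polytime_snd/polytime_fst/polytime_id.
- by apply: pboundS; case: cl.
by move=> x c a al; case: (P x a); rewrite ?esize_cons; lia.
Qed.

Lemma polytime_size A {eA : encoding A} (l : X -> seq A) :
  polytime l -> polytime (fun x => size (l x)).
Proof.
move=> cl; apply: (polytime_ext (f := fun x => foldr (fun=> S) 0 (l x))).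
  by move=> x; elim: (l x) => //= a s ->.
apply: (polytime_foldr (g := fun x a c => c.+1) (h := fun=> 2)) => //.
- exact: polytime_const.
- exact/polytime_succn/polytime_snd/polytime_fst/polytime_id.
- exact: pbound_const.
by move=> x c a _; rewrite !esize_nat doubleS; lia.
Qed.

Lemma polytime_eq0 (m : X -> nat) : polytime m -> polytime (fun x => m x == 0).
Proof.
apply: (polytime_comp (g := fun n => n == 0)); split.
  by apply: pbound_le (pbound_const 3) => n; exact: esize_bool.
exists (PIf PId PLeaf (PNode PLeaf PLeaf)), (fun=> 5); split; first exact: pbound_const.
case=> [|n]; last first.
  by exists 3 => //; apply: (@RunIfTrue _ _ _ _ _ _ _ 1 1); constructor.
exists 5 => //; apply: (@RunIfFalse _ _ _ _ _ 1 3); first exact: RunId.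
by apply: (@RunNode _ _ _ _ _ 1 1); constructor.
Qed.

Lemma polytime_negb (b : X -> bool) : polytime b -> polytime (fun x => ~~ b x).
Proof. by move=> cb; apply: polytime_if => //; exact: polytime_const. Qed.

Lemma polytime_andb (b c : X -> bool) :
  polytime b -> polytime c -> polytime (fun x => b x && c x).
Proof. by move=> cb cc; apply: polytime_if => //; exact: polytime_const. Qed.

Lemma polytime_orb (b c : X -> bool) :
  polytime b -> polytime c -> polytime (fun x => b x || c x).
Proof. by move=> cb cc; apply: polytime_if => //; exact: polytime_const. Qed.

Lemma polytime_eqb (b c : X -> bool) :
  polytime b -> polytime c -> polytime (fun x => b x == c x).
Proof.
move=> cb cc; apply: (polytime_ext (f := fun x => if b x then c x else ~~ c x)).
  by move=> x; case: (b x) (c x) => -[].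
by apply: polytime_if => //; exact: polytime_negb.
Qed.

End Lists.

Section Counting.
Context {X : Type} {eX : encoding X}.

Lemma polytime_count A {eA : encoding A} (l : X -> seq A) (P : X -> pred A) :
  polytime l -> polytime (fun z : X * A => P z.1 z.2) ->
  polytime (fun x => count (P x) (l x)).
Proof.
move=> cl cP; apply: (polytime_ext (f := fun x => size [seq a <- l x | P x a])).
  by move=> x; rewrite size_filter.
exact/polytime_size/polytime_filter.
Qed.

Lemma polytime_has A {eA : encoding A} (l : X -> seq A) (P : X -> pred A) :
  polytime l -> polytime (fun z : X * A => P z.1 z.2) ->
  polytime (fun x => has (P x) (l x)).
Proof.
move=> cl cP; apply: (polytime_ext (f := fun x => ~~ (count (P x) (l x) == 0))).
  by move=> x; rewrite has_count lt0n.
exact/polytime_negb/polytime_eq0/polytime_count.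
Qed.

Lemma polytime_all A {eA : encoding A} (l : X -> seq A) (P : X -> pred A) :
  polytime l -> polytime (fun z : X * A => P z.1 z.2) ->
  polytime (fun x => all (P x) (l x)).
Proof.
move=> cl cP; apply: (polytime_ext (f := fun x => ~~ has (fun a => ~~ P x a) (l x))).
  by move=> x; rewrite has_predC negbK.
by apply/polytime_negb/(polytime_has (P := fun x a => ~~ P x a)) => //;
   exact: (polytime_negb cP).
Qed.

End Counting.

Section Iteration.
Context {X : Type} {eX : encoding X}.

Lemma polytime_iter B {eB : encoding B} (n : X -> nat) (b : X -> B)
    (g : X -> B -> B) (h : X -> nat) :
  polytime n -> polytime b -> polytime (fun z : X * B => g z.1 z.2) -> pbound h ->
  (forall x c, esize (g x c) <= esize c + h x) ->
  polytime (fun x => iter (n x) (g x) (b x)).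
Proof.
move=> cn cb cg bh gh.
apply: (polytime_ext (f := fun x => foldl (fun c _ => g x c) (b x) (nseq (n x) tt))).
  by move=> x; rewrite foldl_units size_nseq.
apply: (polytime_foldl_add (g := fun x c _ => g x c) (h := h)) => //.
  exact: polytime_units.
by apply: (polytime_comp cg); apply/polytime_fst/polytime_id.
Qed.

Lemma polytime_addn (m n : X -> nat) :
  polytime m -> polytime n -> polytime (fun x => m x + n x).
Proof.
move=> cm cn; apply: (polytime_ext (f := fun x => iter (n x) S (m x))).
  by move=> x; rewrite iter_succn.
apply: (polytime_iter (g := fun=> S) (h := fun=> 2)) => //.
- exact/polytime_succn/polytime_snd/polytime_id.
- exact: pbound_const.
by move=> x c; rewrite !esize_nat doubleS; lia.
Qed.

Lemma polytime_predn (m : X -> nat) : polytime m -> polytime (fun x => (m x).-1).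
Proof.
apply: polytime_comp; apply: (polytime_step (p := PRight)).
  by apply: pbound_le pbound_size => n; rewrite !esize_nat; lia.
by case=> [|n]; exact: RunRight.
Qed.

End Iteration.

Section Arithmetic.
Context {X : Type} {eX : encoding X}.

Lemma polytime_leq (m n : X -> nat) :
  polytime m -> polytime n -> polytime (fun x => m x <= n x).
Proof.
move=> cm cn; apply: (polytime_ext (f := fun x => iter (n x) predn (m x) == 0)).
  move=> x; rewrite -subn_eq0; congr (_ == _).
  by elim: (n x) => [|k /= ->]; rewrite ?subn0 ?subnS.
apply: polytime_eq0; apply: (polytime_iter (g := fun=> predn) (h := fun=> 0)) => //.
- exact/polytime_predn/polytime_snd/polytime_id.
- exact: pbound_const.
by move=> x c; rewrite !esize_nat; lia.
Qed.

Lemma polytime_eqn (m n : X -> nat) :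
  polytime m -> polytime n -> polytime (fun x => m x == n x).
Proof.
move=> cm cn; apply: (polytime_ext (f := fun x => (m x <= n x) && (n x <= m x))).
  by move=> x; rewrite eqn_leq.
by apply: polytime_andb; exact: polytime_leq.
Qed.

Lemma polytime_eqlit (l m : X -> bool * nat) :
  polytime l -> polytime m -> polytime (fun x => l x == m x).
Proof.
move=> cl cm; apply: (polytime_ext (f := fun x => ((l x).1 == (m x).1) && ((l x).2 == (m x).2))).
  by move=> x; case: (l x) (m x) => [a b] [c d].
have [cl1 cl2] := (polytime_fst cl, polytime_snd cl).
have [cm1 cm2] := (polytime_fst cm, polytime_snd cm).
exact: polytime_andb (polytime_eqb cl1 cm1) (polytime_eqn cl2 cm2).
Qed.

End Arithmetic.

Section Sums.
Context {X : Type} {eX : encoding X}.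

Lemma polytime_sumn (l : X -> seq nat) : polytime l -> polytime (fun x => sumn (l x)).
Proof.
move=> cl; apply: (polytime_foldr (g := fun=> addn) (h := fun x => esize (l x))) => //.
- exact: polytime_const.
- by apply: polytime_addn; [apply/polytime_snd/polytime_id | apply/polytime_snd/polytime_fst/polytime_id].
- by case: cl.
by move=> x c a; rewrite !esize_nat doubleD; lia.
Qed.

Lemma polytime_muln (m n : X -> nat) :
  polytime m -> polytime n -> polytime (fun x => m x * n x).
Proof.
move=> cm cn; apply: (polytime_ext (f := fun x => sumn [seq m x | _ <- nseq (n x) tt])).
  by move=> x; rewrite map_nseq sumn_nseq.
apply/polytime_sumn/(polytime_map (f := fun x _ => m x)); first exact: polytime_units.
by apply: (polytime_comp cm); exact/polytime_fst/polytime_id.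
Qed.

Lemma polytime_nth A {eA : encoding A} (a0 : A) (l : X -> seq A) (n : X -> nat) :
  enc a0 = Leaf -> polytime l -> polytime n -> polytime (fun x => nth a0 (l x) (n x)).
Proof.
move=> a0E cl cn; apply: (polytime_ext (f := fun x => head a0 (iter (n x) behead (l x)))).
  move=> x; have -> k s : iter k behead s = drop k s.
    by elim: k s => [|k IHk] s; rewrite ?drop0 // iterSr IHk; case: s.
  by rewrite -nth0 nth_drop addn0.
apply: polytime_head => //; apply: (polytime_iter (g := fun=> behead) (h := fun=> 0)) => //.
- exact/polytime_behead/polytime_snd/polytime_id.
- exact: pbound_const.
by move=> x [|c s] //=; rewrite esize_cons; lia.
Qed.

Lemma polytime_index (l : X -> seq nat) (m : X -> nat) :
  polytime l -> polytime m -> polytime (fun x => index (m x) (l x)).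
Proof.
move=> cl cm.
apply: (polytime_ext (f := fun x => foldr (fun a c => if a == m x then 0 else c.+1) 0 (l x))).
  by move=> x; rewrite /index; elim: (l x) => //= a s ->.
apply: (polytime_foldr (g := fun x a c => if a == m x then 0 else c.+1) (h := fun=> 2)) => //.
- exact: polytime_const.
- apply: polytime_if; first apply: polytime_eqn.
  + exact/polytime_snd/polytime_id.
  + by apply: (polytime_comp cm); exact/polytime_fst/polytime_fst/polytime_id.
  + exact: polytime_const.
  + exact/polytime_succn/polytime_snd/polytime_fst/polytime_id.
- exact: pbound_const.
by move=> x c a _; case: eqP; rewrite !esize_nat ?doubleS; lia.
Qed.

(** Consing the current length onto the accumulator produces the numbers in decreasing order. The
    increment depends on the accumulator, so its size is bounded over the whole loop instead of step
    by step. *)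
Lemma polytime_iota (n : X -> nat) : polytime n -> polytime (fun x => iota 0 (n x)).
Proof.
move=> cn; pose f s (_ : unit) := size s :: s : seq nat.
have fE s : foldl f [::] s = rev (iota 0 (size s)).
  elim/last_ind: s => // s a IHs; rewrite foldl_rcons IHs size_rcons -addn1 iotaD.
  by rewrite rev_cat /f size_rev size_iota.
apply: (polytime_ext (f := fun x => rev (foldl f [::] (nseq (n x) tt)))).
  by move=> x; rewrite fE revK size_nseq.
apply: polytime_rev; apply: polytime_foldl.
- exact: polytime_units.
- exact: polytime_const.
- by apply: polytime_cons; [apply: polytime_size | ]; exact/polytime_snd/polytime_fst/polytime_id.
exists (fun x => (n x * (n x).*2.+2).+1).
  have bn : pbound n.
    by case: cn => bn _; apply: pbound_le bn => x; rewrite esize_nat; lia.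
  apply/pboundS/pboundM => //; apply/pboundS/pboundS.
  by apply: pbound_le (pboundD bn bn) => x; rewrite addnn.
move=> x s t /(congr1 size); rewrite size_nseq size_cat fE => nE.
apply: leq_trans (esize_seq (M := (n x).*2.+1) _) _.
  by apply/allP => a; rewrite mem_rev mem_iota esize_nat; lia.
by rewrite size_rev size_iota ltnS leq_mul2r; lia.
Qed.

End Sums.

Lemma polytime_mem (A : eqType) X {eA : encoding A} {eX : encoding X}
    (l : X -> seq A) (a : X -> A) :
  polytime (fun z : A * A => z.1 == z.2) -> polytime l -> polytime a ->
  polytime (fun x => a x \in l x).
Proof.
move=> ceq cl ca; apply: (polytime_ext (f := fun x => has (fun y => a x == y) (l x))).
  by move=> x; rewrite -has_pred1; apply: eq_has => y; exact: eq_sym.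
apply: polytime_has => //; apply: (polytime_comp (f := fun z => (a z.1, z.2)) ceq).
by apply: polytime_pair; [apply: (polytime_comp ca); apply/polytime_fst/polytime_id
                      | apply/polytime_snd/polytime_id].
Qed.

Lemma polytime_mem_nat X {eX : encoding X} (l : X -> seq nat) (a : X -> nat) :
  polytime l -> polytime a -> polytime (fun x => a x \in l x).
Proof.
apply: polytime_mem; apply: polytime_eqn; first exact/polytime_fst/polytime_id.
exact/polytime_snd/polytime_id.
Qed.

Lemma polytime_mem_lit X {eX : encoding X} (l : X -> seq (bool * nat))
    (a : X -> bool * nat) :
  polytime l -> polytime a -> polytime (fun x => a x \in l x).
Proof.
apply: polytime_mem; apply: polytime_eqlit; first exact/polytime_fst/polytime_id.
exact/polytime_snd/polytime_id.
Qed.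

(** * The algorithm *)

Ltac polytime_step :=
  lazymatch goal with
  | |- polytime fst => exact: (polytime_fst polytime_id)
  | |- polytime snd => exact: (polytime_snd polytime_id)
  | |- polytime (fun x => x) => exact: polytime_id
  | |- polytime (fun x => fst (@?f x)) => refine (polytime_fst (f := f) _)
  | |- polytime (fun x => snd (@?f x)) => refine (polytime_snd (f := f) _)
  | |- polytime (fun x => pair (@?f x) (@?g x)) =>
      refine (polytime_pair (f := f) (g := g) _ _)
  | |- polytime (fun x => ~~ @?b x) => refine (polytime_negb (b := b) _)
  | |- polytime (fun x => @?b x && @?c x) =>
      refine (polytime_andb (b := b) (c := c) _ _)
  | |- polytime (fun x => @?b x || @?c x) =>
      refine (polytime_orb (b := b) (c := c) _ _)
  | |- polytime (fun x => cons (@?a x) (@?l x)) =>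
      refine (polytime_cons (a := a) (l := l) _ _)
  | |- polytime (fun x => S (@?m x)) => refine (polytime_succn (m := m) _)
  | |- polytime (fun x => leq (@?m x) (@?n x)) =>
      refine (polytime_leq (m := m) (n := n) _ _)
  | |- polytime (fun x => muln (@?m x) (@?n x)) =>
      refine (polytime_muln (m := m) (n := n) _ _)
  | |- polytime (fun x => @eq_op _ (@?m x) (@?n x)) =>
      first [refine (polytime_eqn (m := m) (n := n) _ _)
            | refine (polytime_eqlit (l := m) (m := n) _ _)]
  | |- polytime (fun x => sumn (@?l x)) => refine (polytime_sumn (l := l) _)
  | |- polytime (fun x => size (@?l x)) => refine (polytime_size (l := l) _)
  | |- polytime (fun x => iota 0 (@?n x)) => refine (polytime_iota (n := n) _)
  | |- polytime (fun x => index (@?m x) (@?l x)) =>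
      refine (polytime_index (m := m) (l := l) _ _)
  | |- polytime (fun x => nth ?a (@?l x) (@?n x)) =>
      refine (polytime_nth (l := l) (n := n) erefl _ _)
  | |- polytime (fun x => in_mem (@?a x) (mem (@?l x))) =>
      first [refine (polytime_mem_nat (a := a) (l := l) _ _)
            | refine (polytime_mem_lit (a := a) (l := l) _ _)]
  | |- polytime (fun x => map (@?f x) (@?l x)) =>
      refine (polytime_map (f := f) (l := l) _ _)
  | |- polytime (fun x => seq.filter (@?P x) (@?l x)) =>
      refine (polytime_filter (P := P) (l := l) _ _)
  | |- polytime (fun x => has (@?P x) (@?l x)) =>
      refine (polytime_has (P := P) (l := l) _ _)
  | |- polytime (fun x => all (@?P x) (@?l x)) =>
      refine (polytime_all (P := P) (l := l) _ _)
  | |- polytime (fun x => count (@?P x) (@?l x)) =>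
      refine (polytime_count (P := P) (l := l) _ _)
  | |- _ => first [assumption | exact: polytime_const | apply: polytime_if]
  end; cbv beta.
Ltac polytime := cbv beta zeta; repeat polytime_step.

(** The sign comes first, so that the product encoding coincides with [enc_literal]. *)
Notation lit := (bool * nat)%type.
Notation cnf := (seq (seq lit)).

Definition inside (vs : seq nat) (C : seq lit) := all (fun l : lit => l.2 \in vs) C.

Definition coverage (F : cnf) (vs : seq nat) := count (inside vs) F.

Definition better (F : cnf) (vs w : seq nat) (y : nat) :=
  let u := [seq z <- vs | z != y] in
  if coverage F w < coverage F u then u else w.

(** Keeping the most clauses amounts to deleting the variable that occurs in the fewest. The
    starting value [[::]] stays only if no deletion keeps strictly more clauses than it does. *)
Definition best (F : cnf) (vs : seq nat) := foldl (better F vs) [::] vs.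

Section Algorithm.
Variables (w : seq nat) (b : nat).

(** [w] and [b] are constants built into the program: scaled and rounded forms of the coefficients
    of $W_S$ and $r$ in the stopping test. *)
Definition affordable (F : cnf) (vs : seq nat) :=
  b * count (fun C => ~~ inside vs C) F <=
  sumn [seq nth 0 w (size C) | C <- [seq C <- F | inside vs C]].

Definition shrink (F : cnf) (vs : seq nat) :=
  if affordable F (best F vs) then best F vs else vs.

(** There is no early exit: once the best deletion fails the test, [shrink] leaves the list fixed in
    all later rounds. *)
Definition core (I : nat * cnf) := iter I.1 (shrink I.2) (iota 0 I.1).

(** Variables are renumbered by their position in [vs], so that the exact program sees an instance
    on [size vs] variables only. *)
Definition restrict (F : cnf) (vs : seq nat) : cnf :=
  [seq [seq (l.1, index l.2 vs) | l : lit <- C] | C <- [seq C <- F | inside vs C]].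

Definition negl (l : lit) := (~~ l.1, l.2).

Definition lits (vs : seq nat) (a : seq bool) : seq lit :=
  [seq (nth false a (index y vs), y) | y <- vs].

(* A set [L] of literals stands for the partial assignment making them true. *)
Definition decided (L : seq lit) (C : seq lit) :=
  all (fun l : lit => (l \in L) || (negl l \in L)) C.

(** Requiring [decided] makes an assignment of the core score exactly on the clauses inside the
    core. *)
Definition lsat (L : seq lit) (C : seq lit) :=
  [&& has (fun l : lit => l \in L) C, has (fun l : lit => negl l \in L) C & decided L C].

Definition extend (F : cnf) (L : seq lit) (y : nat) :=
  if count (lsat ((false, y) :: L)) F <= count (lsat ((true, y) :: L)) F
  then (true, y) :: L else (false, y) :: L.

Definition complete (F : cnf) (n : nat) (vs : seq nat) (L : seq lit) :=
  foldl (fun L y => if y \in vs then L else extend F L y) L (iota 0 n).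

Definition subproblem (I : nat * cnf) :=
  (size (core I), restrict I.2 (core I)).

Definition solution (I : nat * cnf) (a : seq bool) : seq bool :=
  let vs := core I in
  let L := complete I.2 I.1 vs (lits vs a) in
  [seq (true, i) \in L | i <- iota 0 I.1].

Lemma polytime_coverage X {eX : encoding X} (F : X -> cnf) (v : X -> seq nat) :
  polytime F -> polytime v -> polytime (fun x => coverage (F x) (v x)).
Proof.
move=> cF cv; apply: (polytime_comp (f := fun x => (F x, v x))
  (g := fun z : cnf * seq nat => coverage z.1 z.2)); last exact: polytime_pair.
by rewrite /coverage /inside; polytime.
Qed.

(** This form yields at once that [best] creates no repetition, no new variable and no larger
    encoding. *)
Lemma best_filter F vs : exists P, best F vs = [seq y <- vs | P y].
Proof.
rewrite /best; have : exists P, [::] = [seq y <- vs | P y] by exists pred0; rewrite filter_pred0.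
elim: {3}vs [::] => //= y s IHs u [P uE]; apply: IHs; rewrite /better.
by case: ifP => _; [exists (fun z => z != y) | exists P].
Qed.

Lemma polytime_best X {eX : encoding X} (F : X -> cnf) (v : X -> seq nat) :
  polytime F -> polytime v -> polytime (fun x => best (F x) (v x)).
Proof.
move=> cF cv; apply: (polytime_comp (f := fun x => (F x, v x))
  (g := fun z : cnf * seq nat => best z.1 z.2)); last exact: polytime_pair.
rewrite /best.
apply: (polytime_foldl_add (g := fun z : cnf * seq nat => better z.1 z.2)
   (h := fun z : cnf * seq nat => esize z)); try by polytime.
- by rewrite /better; polytime; apply: polytime_coverage; polytime.
- exact: pbound_size.
move=> [G vs] c a _ /=; rewrite /better; case: ifP => _; last by lia.
by apply: leq_trans (esize_filter _ _) _; rewrite esize_pair; lia.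
Qed.

Lemma polytime_core : polytime core.
Proof.
rewrite /core.
apply: (polytime_iter (n := fst) (g := fun I : nat * cnf => shrink I.2) (h := fun=> 0)).
- by polytime.
- by polytime.
- by rewrite /shrink /affordable /inside; polytime; apply: polytime_best; polytime.
- exact: pbound_const.
move=> I vs; rewrite /shrink; case: ifP; rewrite addn0 // => _.
by have [P ->] := best_filter I.2 vs; exact: esize_filter.
Qed.

Lemma polytime_subproblem : polytime subproblem.
Proof.
have cc := polytime_core; rewrite /subproblem /restrict /inside; polytime;
  by apply: (polytime_comp cc); polytime.
Qed.

Lemma esize_extend F L y : esize (extend F L y) <= esize L + (esize y + 5).
Proof.
rewrite /extend; case: ifP => _; rewrite esize_cons esize_pair.
  by have := esize_bool true; lia.
by have := esize_bool false; lia.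
Qed.

Lemma polytime_complete X {eX : encoding X} (F : X -> cnf) (n : X -> nat)
    (vs : X -> seq nat) (L : X -> seq lit) :
  polytime F -> polytime n -> polytime vs -> polytime L ->
  polytime (fun x => complete (F x) (n x) (vs x) (L x)).
Proof.
move=> cF cn cv cL.
apply: (polytime_comp (f := fun x => (F x, n x, vs x, L x))
  (g := fun z : cnf * nat * seq nat * seq lit => complete z.1.1.1 z.1.1.2 z.1.2 z.2)); last first.
  by do 3 apply: polytime_pair => //.
have ci : polytime (fun z : cnf * nat * seq nat * seq lit => iota 0 z.1.1.2).
  by polytime.
apply: (polytime_foldl_add
   (g := fun (z : cnf * nat * seq nat * seq lit) (L : seq lit) (y : nat) => if y \in z.1.2 then L else extend z.1.1.1 L y)
   (h := fun z => esize (iota 0 z.1.1.2) + 5) ci); try by polytime.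
- by rewrite /extend /lsat /decided /negl; polytime.
- by case: ci => bi _; exact: pboundD bi (pbound_const 5).
move=> z c a al; case: ifP => _; first by rewrite leq_addr.
by apply: leq_trans (esize_extend _ _ _) _; lia.
Qed.

Lemma polytime_solution : polytime (fun z => solution z.1 z.2).
Proof.
rewrite /solution; polytime; apply: polytime_complete; polytime;
  try exact: (polytime_comp polytime_core);
  by rewrite /lits; polytime; apply: (polytime_comp polytime_core); polytime.
Qed.

End Algorithm.

(** * Greedy extension of a partial assignment *)

Section Extension.
Implicit Types (L C : seq lit) (F : cnf) (vs : seq nat) (y z : nat) (l m : lit).

Definition known L y := ((true, y) \in L) || ((false, y) \in L).

Definition consistent L := forall y, ~~ (((true, y) \in L) && ((false, y) \in L)).

Lemma knownE L l : known L l.2 = (l \in L) || (negl l \in L).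
Proof. by case: l => [[] y]; rewrite /known //= orbC. Qed.

Lemma decidedE L C : decided L C = all (fun l : lit => known L l.2) C.
Proof. by apply: eq_all => l; rewrite knownE. Qed.

Lemma known_cons b y z L : known ((b, y) :: L) z = (z == y) || known L z.
Proof.
by rewrite /known !inE !xpair_eqE; case: b; case: (z == y) => //=; rewrite orbT.
Qed.

Lemma decided_mono b y L C : decided L C -> decided ((b, y) :: L) C.
Proof.
by rewrite !decidedE; apply: sub_all => l; rewrite known_cons => ->; rewrite orbT.
Qed.

Lemma lsat_mono b y L C : lsat L C -> lsat ((b, y) :: L) C.
Proof.
case/and3P=> /hasP[l lC lL] /hasP[m mC mL] d; apply/and3P; split.
- by apply/hasP; exists l => //; rewrite inE lL orbT.
- by apply/hasP; exists m => //; rewrite inE mL orbT.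
- exact: decided_mono.
Qed.

(* One of the two values of the last undecided variable of a clause satisfies
   it: the clause has another literal, which is either the negation of the
   literal on that variable, or already has a value. *)
Lemma lsat_split L C y : uniq C -> 1 < size C -> ~~ known L y ->
  2 * lsat L C + decided ((true, y) :: L) C <=
  lsat ((true, y) :: L) C + lsat ((false, y) :: L) C + decided L C.
Proof.
move=> uC sC yL; have [dL|dL] := boolP (decided L C).
  rewrite (decided_mono true y dL); case sL: (lsat L C).
    by rewrite !lsat_mono.
  by rewrite muln0 leq_addl.
have -> : lsat L C = false by rewrite /lsat (negPf dL) !andbF.
have [dT|//] := boolP (decided ((true, y) :: L) C).
have dB b : decided ((b, y) :: L) C.
  by move: dT; rewrite !decidedE; apply: sub_all => l; rewrite !known_cons.
suff : lsat ((true, y) :: L) C || lsat ((false, y) :: L) C.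
  by case/orP=> ->; rewrite ?addn1 // addnC.
rewrite {1 2}/lsat !dB !andbT.
move: dL; rewrite decidedE => /allPn[[c z] lC lL].
have zy : z = y.
  move: dT; rewrite decidedE => /allP /(_ _ lC); rewrite known_cons (negPf lL) orbF.
  by move/eqP.
rewrite {z lL}zy in lC.
have [m mC ml] : exists2 m, m \in C & m != (c, y).
  have /hasP[m mC mP] : has (predC (pred1 (c, y))) C.
    by rewrite has_count -(ltn_add2l (count (pred1 (c, y)) C)) count_predC addn0
         (count_uniq_mem _ uC) lC.
  by exists m.
have [my|my] := eqVneq m.2 y.
  have mE : m = (~~ c, y).
    by case: m my ml {mC} => d z /= ->; rewrite xpair_eqE eqxx andbT; case: d c {lC} => -[].
  apply/orP; left; apply/andP; split; apply/hasP.
    by case: c lC mE {ml} => lC mE; [exists (true, y) | exists m]; rewrite // ?mE inE eqxx.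
  by case: c lC mE {ml} => lC mE; [exists m | exists (false, y)]; rewrite // ?mE inE eqxx.
have : known L m.2.
  by move: dT; rewrite decidedE => /allP /(_ _ mC); rewrite known_cons (negPf my).
have inE' b l : (l \in L) -> (l \in (b, y) :: L) by rewrite inE orbC => ->.
(* If [m] is true, the value of [y] that makes [(c, y)] false is taken; if [m] is false, the one
   that makes it true. *)
rewrite knownE => /orP[mL|mL]; apply/orP; case: c lC {ml} => lC.
- right; apply/andP; split; apply/hasP; first by exists m => //; exact: inE'.
  by exists (true, y); rewrite // inE eqxx.
- left; apply/andP; split; apply/hasP; first by exists m => //; exact: inE'.
  by exists (false, y); rewrite // inE eqxx.
- left; apply/andP; split; apply/hasP; last by exists m => //; exact: inE'.
  by exists (true, y); rewrite // inE eqxx.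
- right; apply/andP; split; apply/hasP; last by exists m => //; exact: inE'.
  by exists (false, y); rewrite // inE eqxx.
Qed.

Definition proper F := all (fun C => uniq C && (1 < size C)) F.

(** The greedy choice is at least the mean of the two options. Summing [lsat_split] over the
    clauses, twice the satisfied count minus the decided count never decreases. *)
Lemma extend_gain F L y : proper F -> ~~ known L y ->
  2 * count (lsat L) F + count (decided (extend F L y)) F <=
  2 * count (lsat (extend F L y)) F + count (decided L) F.
Proof.
move=> pF yL.
have dE b : count (decided ((b, y) :: L)) F = count (decided ((true, y) :: L)) F.
  by apply: eq_count => C; rewrite !decidedE; apply: eq_all => l; rewrite !known_cons.
have : 2 * count (lsat L) F + count (decided ((true, y) :: L)) F <=
  count (lsat ((true, y) :: L)) F + count (lsat ((false, y) :: L)) F + count (decided L) F.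
  elim: F pF {dE} => // C F IHF /andP[/andP[uC sC] /IHF].
  have cE P : count P (C :: F) = P C + count P F by [].
  by rewrite !cE; have := lsat_split uC sC yL; lia.
by rewrite /extend; case: ifP => le; rewrite ?(dE false); lia.
Qed.

Lemma extendE F L y : exists b, extend F L y = (b, y) :: L.
Proof. by rewrite /extend; case: ifP => _; [exists true | exists false]. Qed.

Lemma consistent_cons b y L : consistent L -> ~~ known L y ->
  consistent ((b, y) :: L).
Proof.
move=> cL yL z; rewrite !inE !xpair_eqE; have [->|] := eqVneq z y.
  by move: yL; rewrite /known negb_or => /andP[/negPf -> /negPf ->]; case: b.
by rewrite !andbF => _; exact: cL.
Qed.

(** The increments of [extend_gain] telescope over the variables outside [vs], each of which still
    has no value when it is reached. *)
Lemma complete_gain F n vs L : proper F -> consistent L ->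
  (forall y, known L y = (y \in vs)) ->
  let L' := complete F n vs L in
  [/\ consistent L', forall y, known L' y = (y \in vs) || (y < n) &
      2 * count (lsat L) F + count (decided L') F <=
      2 * count (lsat L') F + count (decided L) F].
Proof.
move=> pF cL kL; rewrite /complete /=; set f := fun L => _.
suff : forall s, uniq s -> let L' := foldl f L s in
  [/\ consistent L', forall y, known L' y = (y \in vs) || (y \in s) &
      2 * count (lsat L) F + count (decided L') F <=
      2 * count (lsat L') F + count (decided L) F].
  move=> /(_ _ (iota_uniq 0 n)) [cL' kL' gL']; split=> // y.
  by rewrite kL' mem_iota.
elim/last_ind => [|s y IHs]; first by split=> // y; rewrite kL orbF.
rewrite rcons_uniq => /andP[ys /IHs] /=.
rewrite foldl_rcons; set M := foldl f L s => -[cM kM gM].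
rewrite {1 2 3 4}/f; case: ifP => yv.
  split=> // z; rewrite kM mem_rcons inE.
  by have [->|] := eqVneq z y; rewrite ?yv.
have yM : ~~ known M y by rewrite kM yv.
have [b eE] := extendE F M y; split.
- by rewrite eE; exact: consistent_cons.
- by move=> z; rewrite eE known_cons kM mem_rcons inE orbCA.
- by have := extend_gain pF yM; lia.
Qed.

Lemma mem_lits vs a b y :
  ((b, y) \in lits vs a) = (y \in vs) && (nth false a (index y vs) == b).
Proof.
apply/mapP/andP => [[z zv [-> ->]]|[yv /eqP <-]]; first by rewrite zv.
by exists y.
Qed.

Lemma known_lits vs a y : known (lits vs a) y = (y \in vs).
Proof. by rewrite /known !mem_lits; case: (y \in vs) (nth _ _ _) => -[]. Qed.

Lemma consistent_lits vs a : consistent (lits vs a).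
Proof. by move=> y; rewrite !mem_lits; case: (y \in vs) (nth _ _ _) => -[]. Qed.

Definition asat (f : nat -> bool) C :=
  has (fun l : lit => f l.2 == l.1) C && has (fun l : lit => f l.2 != l.1) C.

Definition value F f := count (asat f) F.

Lemma lsatE (f : nat -> bool) L C :
  (forall l, l \in C -> forall b, ((b, l.2) \in L) = (f l.2 == b)) ->
  lsat L C = asat f C.
Proof.
move=> LE; rewrite /lsat /asat.
have -> : decided L C.
  by rewrite decidedE; apply/allP => l lC; rewrite /known !LE //; case: (f _).
rewrite andbT; congr (_ && _); apply: eq_in_has => l /LE lE.
  by rewrite -lE; case: l {lE}.
by rewrite /negl lE; case: (f _) l.1 => -[].
Qed.

(** Clauses not inside [vs] are never decided by [lits vs a], and the other ones are only
    renumbered. *)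
Lemma value_restrict F vs a :
  value (restrict F vs) (nth false a) = count (lsat (lits vs a)) F.
Proof.
rewrite /value /restrict count_map count_filter; apply: eq_count => C /=.
have [iC|iC] := boolP (inside vs C); last first.
  rewrite andbF; apply/esym/negbTE; apply: contra iC => /and3P[_ _].
  by rewrite decidedE; apply: sub_all => l; rewrite known_lits.
rewrite andbT (lsatE (f := fun y => nth false a (index y vs))).
  by rewrite /asat !has_map.
by move=> l /(allP iC) lv b; rewrite mem_lits lv.
Qed.

(** At the start exactly the clauses inside [vs] are decided, at the end all of them, so the
    potential inequality credits half of the lost clauses. *)
Lemma value_complete F n vs L : proper F -> consistent L ->
  (forall y, known L y = (y \in vs)) -> all (fun C => all (fun l : lit => l.2 < n) C) F ->
  2 * count (lsat L) F + count (fun C => ~~ inside vs C) F <=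
  2 * value F (nth false [seq (true, i) \in complete F n vs L | i <- iota 0 n]).
Proof.
move=> pF cL kL bF; have [] := complete_gain n pF cL kL; set L' := complete _ _ _ _.
move=> cL' kL'; set f := nth _ _.
have LE C : C \in F -> forall l, l \in C -> forall b, ((b, l.2) \in L') = (f l.2 == b).
  move=> CF l lC b; have ln := allP (allP bF _ CF) _ lC.
  rewrite /f (nth_map 0) ?size_iota // nth_iota // add0n.
  have := kL' l.2; rewrite ln orbT /known; have := cL' l.2.
  by case: b; case: (_ \in L'); case: (_ \in L').
have -> : count (decided L') F = size F.
  apply/eqP; rewrite -all_count; apply/allP => C CF.
  rewrite decidedE; apply/allP => l lC; rewrite kL'.
  by rewrite (allP (allP bF _ CF) _ lC) orbT.
have -> : count (lsat L') F = value F f.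
  by apply: eq_in_count => C CF; apply: lsatE; exact: LE.
have -> : count (decided L) F = count (inside vs) F.
  by apply: eq_count => C; rewrite decidedE; apply: eq_all => l; rewrite kL.
have := count_predC (inside vs) F.
by rewrite -[count (predC _) F]/(count (fun C => ~~ inside vs C) F); lia.
Qed.

(** Reading [f] on [vs] changes nothing for the clauses inside, so only lost clauses are given up.
    This is the source of $OPT \le OPT_S + r$. *)
Lemma value_le_restrict F vs f :
  value F f <= value (restrict F vs) (fun j => f (nth 0 vs j)) +
               count (fun C => ~~ inside vs C) F.
Proof.
rewrite /value /restrict count_map count_filter.
elim: F => //= C F; rewrite -/(inside vs C); case: (boolP (inside vs C)) => iC /=.
  suff -> : asat (fun j => f (nth 0 vs j)) [seq (l.1, index l.2 vs) | l : lit <- C] = asat f C.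
    by rewrite andbT; lia.
  rewrite /asat !has_map; congr (_ && _); apply: eq_in_has => l /(allP iC) lv /=;
    by rewrite nth_index.
by rewrite andbF; case: (asat f C); lia.
Qed.

End Extension.

(** List form of a [k_instance]: for clauses without repetition, [perm_eq] is equality of the sets
    of literals. *)
Definition well_formed (k n : nat) (F : cnf) :=
  all (fun C => [&& uniq C, 2 <= size C <= k & all (fun l : lit => l.2 < n) C]) F
  && pairwise (fun C D => ~~ perm_eq C D) F.

(** * Greedy deletion of variables *)

Section Greedy.
Implicit Types (F : cnf) (vs : seq nat) (y z : nat).

Lemma bestE F vs : best F vs = [::] \/
  exists2 y, y \in vs & best F vs = [seq z <- vs | z != y].
Proof.
suff H s u : {subset s <= vs} ->
    u = [::] \/ (exists2 y, y \in vs & u = [seq z <- vs | z != y]) ->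
    foldl (better F vs) u s = [::] \/
    exists2 y, y \in vs & foldl (better F vs) u s = [seq z <- vs | z != y].
  by apply: H => //; left.
elim: s u => //= y s IHs u sv uE; apply: IHs.
  by move=> z zs; rewrite sv // inE zs orbT.
by rewrite /better; case: ifP => // _; right; exists y; rewrite // sv ?mem_head.
Qed.

Lemma coverage_best F vs y : y \in vs ->
  coverage F [seq z <- vs | z != y] <= coverage F (best F vs).
Proof.
have mono s u : coverage F u <= coverage F (foldl (better F vs) u s).
  elim: s u => //= z s IHs u; apply: leq_trans (IHs _); rewrite /better.
  by case: ifP => [/ltnW|].
suff H s u : y \in s -> coverage F [seq z <- vs | z != y] <=
    coverage F (foldl (better F vs) u s) by exact: H.
elim: s u => //= z s IHs u; rewrite inE => /predU1P[->|]; last exact: IHs.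
apply: leq_trans (mono _ _); rewrite /better; case: ifP => // /negbT.
by rewrite -leqNgt.
Qed.

Lemma size_best F vs : size (best F vs) <= (size vs).-1.
Proof.
have [->|[y yv ->]] // := bestE F vs.
rewrite size_filter -(count_predC (pred1 y) vs).
have : 0 < count (pred1 y) vs by rewrite -has_count has_pred1.
by rewrite -[count (predC _) _]/(count (fun z => z != y) vs); lia.
Qed.

(** Averaging over the deleted variable: a clause inside [vs] contains at most $k$ variables and
    survives the deletion of any other, and the best deletion is at least as good as the average
    one. *)
Lemma coverage_step k F vs : uniq vs -> all (fun C => size C <= k) F ->
  coverage F vs * (size vs - k) <= coverage F (best F vs) * size vs.
Proof.
move=> uv sF.
apply: leq_trans (_ : \sum_(y <- vs) coverage F [seq z <- vs | z != y] <= _); last first.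
  rewrite -sum1_size big_distrr /= big_seq [leqRHS]big_seq.
  by apply: leq_sum => y yv; rewrite muln1; exact: coverage_best.
elim: F sF => [|C F IHF] /=; first by rewrite mul0n.
move=> /andP[sC /IHF]; rewrite /coverage /= big_split /= mulnDl => IH.
rewrite leq_add // {IH IHF}; case: (boolP (inside vs C)) => iC; last by rewrite mul0n.
rewrite mul1n; pose s := [seq l.2 | l : lit <- C].
have iE y : inside [seq z <- vs | z != y] C = (y \notin s).
  apply/allP/idP => [h|h l lC].
    by apply/mapP => -[l /h]; rewrite mem_filter => /andP[/eqP h1 _ /esym].
  rewrite mem_filter (allP iC _ lC) andbT; apply: contraNneq h => <-.
  exact: (map_f (fun l : lit => l.2)).
under eq_bigr do rewrite iE.
rewrite -big_mkcond sum1_count leq_subLR -(count_predC (mem s) vs).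
rewrite -[count (predC _) _]/(count (fun y => y \notin s) vs) leq_add2r.
apply: leq_trans sC; rewrite -(size_map (fun l : lit => l.2) C) -size_filter.
apply: uniq_leq_size; first exact: filter_uniq.
by move=> y; rewrite mem_filter => /andP[].
Qed.

Lemma leq_ffact k m n : m <= n -> m ^_ k <= n ^_ k.
Proof.
elim: k m n => // k IHk m n mn; rewrite !ffactnS leq_mul // IHk //.
by rewrite -!subn1 leq_sub2r.
Qed.

(** With $s$ variables left, a deletion keeps a fraction of at least $(s-k)/s$ of the clauses, and
    this is exactly the ratio of the falling factorials of $s-1$ and $s$. *)
Lemma coverage_ffact k F vs n : uniq vs -> all (fun C => size C <= k) F ->
  0 < size vs ->
  size F * size vs ^_ k <= coverage F vs * n ^_ k ->
  size F * (size vs).-1 ^_ k <= coverage F (best F vs) * n ^_ k.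
Proof.
move=> uv sF v0 H; rewrite -(leq_pmul2l v0).
have -> : size vs * (size F * (size vs).-1 ^_ k) = size F * size vs ^_ k * (size vs - k).
  by rewrite -[RHS]mulnA -ffactnSr ffactnS; lia.
apply: leq_trans (leq_mul H (leqnn _)) _.
have := leq_mul (coverage_step uv sF) (leqnn (n ^_ k)); lia.
Qed.

(** If the core is nonempty, the process stopped because the list [u] left by the next deletion
    fails the test. The bound on the coverage of [u] is what limits the size of the core. *)
Lemma core_spec w b k n F : all (fun C => size C <= k) F ->
  all (fun C => all (fun l : lit => l.2 < n) C) F ->
  let vs := core w b (n, F) in
  [/\ uniq vs, {subset vs <= iota 0 n}, affordable w b F vs &
      vs = [::] \/ exists2 u, ~~ affordable w b F u &
        size F * (size vs).-1 ^_ k <= coverage F u * n ^_ k].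
Proof.
move=> sF bF; rewrite /core /=.
have in0 : all (inside (iota 0 n)) F.
  apply: sub_all bF => C; apply: sub_all => l; by rewrite mem_iota.
(* After [i] rounds the process is either stuck or has deleted [i] variables; for [i = n] it is
   stuck or the list is empty. *)
have key i : let vs := iter i (shrink w b F) (iota 0 n) in
    [/\ uniq vs, {subset vs <= iota 0 n}, affordable w b F vs,
      size F * size vs ^_ k <= coverage F vs * n ^_ k &
      ~~ affordable w b F (best F vs) \/ size vs <= n - i].
  elim: i => [|i] /=.
    split; rewrite ?iota_uniq ?size_iota //; last by right; rewrite subn0.
      rewrite /affordable (_ : count _ F = 0) ?muln0 //.
      apply/eqP; rewrite -leqn0 leqNgt -has_count -all_predC.
      by apply: sub_all in0 => C /= ->.
    by rewrite leq_mul2r /coverage -(eqP (_ : count (inside (iota 0 n)) F == size F))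
      ?leqnn ?orbT // -all_count.
  set vs := iter _ _ _ => -[uv sv av cv dv]; rewrite /shrink.
  case: ifP => [ab|/negbT ab]; last by split=> //; left.
  (* On the empty list [best] returns the empty list, so nothing changes. *)
  have [/size0nil vE|v0] := posnP (size vs).
    have -> : best F vs = vs by rewrite vE.
    by split=> //; right; rewrite vE.
  have [P bE] := best_filter F vs; split=> //.
  - by rewrite bE filter_uniq.
  - by rewrite bE => y; rewrite mem_filter => /andP[_ /sv].
  - apply: leq_trans (coverage_ffact uv sF v0 cv).
    by rewrite leq_mul2l leq_ffact ?orbT // size_best.
  - right; have := size_best F vs; case: dv => [|dv]; first by rewrite ab.
    lia.
have [uv sv av cv dv] := key n; split=> //.
move: (iter n _ _) uv sv av cv dv => vs uv sv av cv dv.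
have [v0|v0] := posnP (size vs); first by left; apply: size0nil.
right; exists (best F vs); last exact: coverage_ffact.
by case: dv => //; rewrite subnn; lia.
Qed.

End Greedy.
(** * Random assignments *)

Section Averaging.
Variable n : nat.
Implicit Types (C : seq lit) (a : assignment n).

Definition bits a : seq bool := [seq a i | i <- enum 'I_n].

Lemma nth_bits a (i : 'I_n) : nth false (bits a) i = a i.
Proof. by rewrite (nth_map i) ?size_enum_ord // nth_ord_enum. Qed.

Definition flip (i : 'I_n) a : assignment n := [ffun j => a j (+) (j == i)].

Lemma flipK i : involutive (flip i).
Proof. by move=> a; apply/ffunP => j; rewrite !ffunE addbK. Qed.

Definition all_true C a := all (fun l : lit => nth false (bits a) l.2 == l.1) C.

(** Each further literal halves the count: if its variable occurs in [C], it does so with the other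
    sign and no assignment remains; otherwise flipping the variable gives a disjoint copy inside the
    larger set. Complementary literals are why this is only an inequality. *)
Lemma card_all_true C : uniq C -> all (fun l : lit => l.2 < n) C ->
  #|[set a | all_true C a]| * 2 ^ size C <= 2 ^ n.
Proof.
elim: C => [_ _|[b y] C IHC] /=.
  by rewrite muln1; apply: leq_trans (max_card _) _; rewrite card_ffun card_bool card_ord.
case/andP=> lC uC /andP[yn bC]; apply: leq_trans (IHC uC bC).
rewrite expnS mulnA leq_mul2r; apply/orP; right.
set A := [set a | all_true ((b, y) :: C) a].
have [yC|yC] := boolP (has (fun l : lit => l.2 == y) C).
  have /hasP[[c z] lC' /= /eqP zy] := yC; rewrite {z}zy in lC'.
  suff -> : A = finset.set0 by rewrite cards0.
  apply/finset.setP => a; rewrite !inE; apply/negbTE; rewrite /all_true /=.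
  apply: contraNN lC => /andP[/eqP aE /allP /(_ _ lC') /eqP /=].
  by rewrite aE => ->.
pose i := Ordinal yn.
have -> : #|A| * 2 = #|A :|: flip i @: A|.
  rewrite finset.cardsU (card_imset _ (can_inj (flipK i))) addnn -muln2.
  suff -> : A :&: flip i @: A = finset.set0 by rewrite cards0 subn0.
  apply/finset.setP => a; rewrite !inE; apply/negbTE/negP => /andP[/andP[/eqP aE _]].
  case/imsetP => c; rewrite inE => /andP[/eqP cE _] acE; move: aE cE.
  by rewrite -[y]/(nat_of_ord i) !nth_bits acE ffunE eqxx addbT /= => <-; case: (c i).
apply/subset_leq_card/fintype.subsetP => a; rewrite !inE => /orP[/andP[]//|/imsetP[c]].
rewrite inE => /andP[_ cC] ->; apply/allP => l lC'; have := allP cC _ lC'.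
rewrite -[l.2]/(nat_of_ord (Ordinal (allP bC _ lC'))) !nth_bits ffunE.
suff -> : (Ordinal (allP bC _ lC') == i) = false by rewrite addbF.
by apply/negbTE; move/hasPn: yC => /(_ _ lC').
Qed.

(** An assignment fails only by making all literals true or all false, and [card_all_true] bounds
    each case, the second through the negated clause. *)
Lemma card_asat C : uniq C -> all (fun l : lit => l.2 < n) C ->
  2 ^ n * 2 ^ size C <= #|[set a | asat (nth false (bits a)) C]| * 2 ^ size C + 2 * 2 ^ n.
Proof.
move=> uC bC; have uC' : uniq (map negl C).
  by rewrite map_inj_uniq // => -[[] y] [[] z] //= [->].
have bC' : all (fun l : lit => l.2 < n) (map negl C) by rewrite all_map.
have := leq_add (card_all_true uC bC) (card_all_true uC' bC').
rewrite size_map addnn -mul2n -mulnDl => H.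
pose A := [set a | asat (nth false (bits a)) C].
have cA : #|A| + #|~: A| = 2 ^ n by rewrite cardsC card_ffun card_bool card_ord.
rewrite -[in leqLHS]cA mulnDl leq_add2l; apply: leq_trans H.
rewrite leq_mul2r; apply/orP; right.
apply: leq_trans (leq_card_setU _ _); apply/subset_leq_card/fintype.subsetP => a.
rewrite !inE negb_and -!all_predC orbC => /orP[H|H]; apply/orP; [left|right].
  by apply: sub_all H => l /=; rewrite negbK.
by rewrite /all_true all_map; apply: sub_all H => l /=; case: (nth _ _ _) l.1 => -[].
Qed.

(* 2^k times the probability that a random assignment NAE-satisfies a clause of
   [i] literals on distinct variables. *)
Definition weight k i := 2 ^ k - 2 ^ (k.+1 - i).

(** By [card_asat] the mean of the right-hand side over all assignments is at least the total
    weight, so some assignment reaches it. *)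
Lemma average_value k F : well_formed k n F ->
  exists a, sumn [seq weight k (size C) | C <- F] <= 2 ^ k * value F (nth false (bits a)).
Proof.
case/andP=> wF _; set W := sumn _; apply/existsP; apply/contraT.
rewrite negb_exists => /forallP H.
have : \sum_(a : assignment n) 2 ^ k * value F (nth false (bits a)) < \sum_(a : assignment n) W.
  have [|e0] := posnP #|assignment n|; last first.
    have /card_gt0P[a0 _] := e0.
    rewrite (bigD1 a0) //= [ltnRHS](bigD1 a0) //= -addSn leq_add //.
      by rewrite ltnNge H.
    by apply: leq_sum => a _; apply: ltnW; rewrite ltnNge H.
  by rewrite card_ffun card_bool card_ord => /eqP; rewrite expn_eq0.
rewrite ltnNge => /negP[]; rewrite sum_nat_const card_ffun card_bool card_ord -big_distrr /=.
rewrite /W {W H}; elim: F wF => [|C F IHF] /=; first by rewrite muln0.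
case/andP=> /and3P[uC /andP[sC kC] bC] /IHF; rewrite /value /= big_split /= !mulnDr.
move=> IH; rewrite leq_add // {IH IHF}.
have -> : \sum_a asat (nth false (bits a)) C = #|[set a | asat (nth false (bits a)) C]|.
  by rewrite -sum1_card -big_mkcond /=; apply: eq_bigl => a; rewrite inE.
have := card_asat uC bC; set N := #|_|; rewrite /weight => H.
rewrite -(leq_pmul2r (expn_gt0 2 (size C))).
have e : 2 ^ (k.+1 - size C) * 2 ^ size C = 2 * 2 ^ k.
  by rewrite -expnD subnK ?expnS // ltnW.
rewrite mulnBr mulnBl -!mulnA e.
have := leq_mul (leqnn (2 ^ k)) H; lia.
Qed.
End Averaging.

(** * Instances as lists of clauses *)

Section Encoding.
Variable n : nat.
Implicit Types (I : instance n).

Definition code (l : literal n) : lit := (l.2, val l.1).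

Lemma code_inj : injective code.
Proof. by move=> [i b] [j c] [-> /val_inj ->]. Qed.

Lemma nae_sat_code a (C : seq (literal n)) :
  nae_sat a [set l in C] = asat (nth false (bits a)) (map code C).
Proof.
rewrite /nae_sat /asat !has_map; congr (_ && _).
  apply/existsP/hasP => [[l]|[l lC] /=].
    by rewrite inE => /andP[lC lt]; exists l => //=; rewrite nth_bits.
  by rewrite nth_bits => lt; exists l; rewrite inE lC.
apply/existsP/hasP => [[l]|[l lC] /=].
  by rewrite inE => /andP[lC lt]; exists l => //=; rewrite nth_bits.
by rewrite nth_bits => lt; exists l; rewrite inE lC.
Qed.

Lemma set_perm_eq (C D : seq (literal n)) : uniq C -> uniq D ->
  ([set l in C] == [set l in D]) = perm_eq (map code C) (map code D).
Proof.
move=> uC uD; apply/eqP/idP => [/finset.setP CD|/(perm_map_inj code_inj) /perm_mem CD].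
  by apply/perm_map/uniq_perm => // l; have := CD l; rewrite !inE.
by apply/finset.setP => l; rewrite !inE CD.
Qed.

Lemma enc_map A B (eA : A -> tree) (eB : B -> tree) (f : A -> B) s :
  eA =1 eB \o f -> enc_seq eA s = enc_seq eB (map f s).
Proof. by move=> ef; elim: s => //= a s ->; rewrite ef. Qed.

Lemma clause_lists k (s : seq (seq (literal n))) (I : instance n) :
  (forall C, C \in s -> uniq C) ->
  I = [set D in [seq [set l in C] | C <- s]] ->
  (k_instance k I /\ uniq [seq [set l in C] | C <- s]) <->
  well_formed k n [seq map code C | C <- s].
Proof.
move=> us ->; rewrite uniq_pairwise pairwise_map.
have bE : all (fun C => all (fun l : lit => l.2 < n) C) [seq map code C | C <- s].
  by apply/allP => _ /mapP[C _ ->]; apply/allP => _ /mapP[l _ ->] /=.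
have pE : pairwise (fun C D : seq (literal n) => [set l in C] != [set l in D]) s =
    pairwise (fun C D => ~~ perm_eq C D) [seq map code C | C <- s].
  rewrite pairwise_map; apply: (eq_in_pairwise (P := fun C => C \in s)); last exact/allP.
  by move=> C D Cs Ds /=; rewrite -set_perm_eq; [ | exact: us | exact: us].
have cE C : C \in s -> #|[set l in C]| = size C.
  by move=> Cs; rewrite cardsE; apply/card_uniqP/us.
rewrite /well_formed -pE; split=> [[kI ->]|/andP[/allP wF ->]].
  rewrite andbT; apply/allP => _ /mapP[C Cs ->].
  rewrite map_inj_uniq ?us ?size_map //=; last exact: code_inj.
  rewrite (allP bE) ?andbT; last exact: map_f.
  by rewrite -cE // kI // inE map_f.
split=> // C; rewrite inE => /mapP[D Ds ->]; rewrite cE //.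
by have /wF/and3P[_ + _] := map_f (map code) Ds; rewrite size_map.
Qed.

Lemma nae_value_code (s : seq (seq (literal n))) a :
  uniq [seq [set l in C] | C <- s] ->
  nae_value [set D in [seq [set l in C] | C <- s]] a =
  value [seq map code C | C <- s] (nth false (bits a)).
Proof.
move=> us; rewrite /nae_value /value count_map.
have -> : [set C in [set D in [seq [set l in C] | C <- s]] | nae_sat a C] =
    [set D in [seq D <- [seq [set l in C] | C <- s] | nae_sat a D]].
  by apply/finset.setP => C; rewrite !inE mem_filter andbC.
rewrite cardsE (card_uniqP _) ?filter_uniq // size_filter count_map.
by apply: eq_count => C /=; rewrite nae_sat_code.
Qed.

Lemma enc_code (s : seq (seq (literal n))) :
  Node (enc_nat n) (enc_seq (enc_seq (@enc_literal n)) s) =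
  enc (n, [seq map code C | C <- s]).
Proof.
congr Node; apply: enc_map => C; apply: enc_map => -[i b]; by [].
Qed.

Lemma encodes_code k I x : k_instance k I -> encodes I x ->
  exists s : seq (seq (literal n)), let F := [seq map code C | C <- s] in
  [/\ well_formed k n F, x = enc (n, F),
      perm_eq [seq [set l in C] | C <- s] (enum I) &
      forall a, nae_value I a = value F (nth false (bits a))].
Proof.
move=> kI [s [us uI IE xE]]; exists s; split.
- by apply/(clause_lists k us IE).
- by rewrite xE enc_code.
- by apply: uniq_perm; rewrite ?enum_uniq // => C; rewrite mem_enum IE inE.
- by move=> a; rewrite IE nae_value_code.
Qed.

(** Used for the restricted list: the exact program is only guaranteed to work on trees that encode
    instances. *)
Lemma code_encodes k F : well_formed k n F -> exists I : instance n,
  [/\ k_instance k I, encodes I (enc (n, F)) &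
      forall a, nae_value I a = value F (nth false (bits a))].
Proof.
move=> wF; have [s sE] : exists s : seq (seq (literal n)), [seq map code C | C <- s] = F.
  case/andP: wF => /allP wF _; elim: F wF => [|C F IHF] wF; first by exists [::].
  have [|s <-] := IHF; first by move=> D DF; apply: wF; rewrite inE DF orbT.
  have /and3P[_ _ bC] := wF _ (mem_head _ _).
  suff [D <-] : exists D, map code D = C by exists (D :: s).
  elim: C bC {wF} => [_|[b y] C IHC /= /andP[yn /IHC[D <-]]]; first by exists [::].
  by exists ((Ordinal yn, b) :: D).
have us C : C \in s -> uniq C.
  move=> Cs; case/andP: wF => /allP wF _; have := wF (map code C).
  by rewrite -sE map_f // => /(_ erefl) /andP[/map_uniq].
exists [set D in [seq [set l in C] | C <- s]].
have [kI uI] : k_instance k [set D in [seq [set l in C] | C <- s]] /\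
    uniq [seq [set l in C] | C <- s].
  by apply/(clause_lists k us erefl); rewrite sE.
split=> //; last by move=> a; rewrite nae_value_code // sE.
by exists s; split=> //; rewrite enc_code sE.
Qed.

End Encoding.

Arguments code {n} l.

(** * Restricted instances and the size of encodings *)

Section Restriction.
Variables (k n : nat) (F : cnf) (vs : seq nat).
Hypothesis wF : well_formed k n F.

Lemma well_formed_proper : proper F.
Proof.
by case/andP: wF => + _; apply: sub_all => C /and3P[-> /andP[-> _] _].
Qed.

Lemma well_formed_size : all (fun C => size C <= k) F.
Proof. by case/andP: wF => + _; apply: sub_all => C /and3P[_ /andP[_ ->] _]. Qed.

Lemma well_formed_vars : all (fun C => all (fun l : lit => l.2 < n) C) F.
Proof. by case/andP: wF => + _; apply: sub_all => C /and3P[]. Qed.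

(** On clauses inside [vs] the renumbering is inverted by [nth 0 vs], so literals and clauses stay
    distinct. *)
Lemma well_formed_restrict : well_formed k (size vs) (restrict F vs).
Proof.
have renK : {in inside vs, forall C : seq lit,
    [seq (l.1, nth 0 vs l.2) | l : lit <- [seq (l.1, index l.2 vs) | l : lit <- C]] = C}.
  move=> C /allP iC; rewrite -map_comp -[RHS]map_id; apply/eq_in_map => l /iC lv /=.
  by rewrite nth_index //; case: l {lv}.
have fF : all (inside vs) [seq C <- F | inside vs C] := filter_all _ _.
case/andP: wF => wC pF; apply/andP; split.
  apply/allP => D /mapP[C]; rewrite mem_filter => /andP[iC CF] ->.
  have /and3P[uC sC _] := allP wC _ CF; rewrite size_map sC /=; apply/andP; split.
    by apply: (@map_uniq _ _ (fun l : lit => (l.1, nth 0 vs l.2))); rewrite renK.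
  by apply/allP => _ /mapP[l lC ->] /=; rewrite index_mem (allP iC).
rewrite /restrict pairwise_map.
have := pairwise_filter (inside vs) pF.
apply: (sub_in_pairwise (P := inside vs)) fF => C D iC iD /=; apply: contra => CD.
by rewrite -(renK C iC) -(renK D iD); exact: perm_map.
Qed.

Lemma value_le_opt (I : instance n) (f : nat -> bool) :
  (forall a, nae_value I a = value F (nth false (bits a))) ->
  value F f <= nae_opt I.
Proof.
move=> IE; pose a : assignment n := [ffun i => f (val i)].
apply: leq_trans (_ : nae_value I a <= _); last exact: leq_bigmax.
rewrite IE /value; apply: eq_leq; apply: eq_in_count => C CF.
have bC := allP (allP well_formed_vars _ CF).
by rewrite /asat; congr (_ && _); apply: eq_in_has => l /bC ln;
  rewrite -[l.2]/(nat_of_ord (Ordinal ln)) nth_bits ffunE.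
Qed.

End Restriction.

(** A clause of at most $k$ literals is the range of a map from ['I_k] to optional literals, with
    [None] as padding. *)
Lemma card_k_instance k n (I : instance n) : k_instance k I ->
  #|I| <= (n * 2).+1 ^ k.
Proof.
move=> kI; pose S (t : {ffun 'I_k -> option (literal n)}) : clause n :=
  [set l | [exists i, t i == Some l]].
apply: leq_trans (_ : #|S @: [set: {ffun 'I_k -> option (literal n)}]| <= _).
  apply/subset_leq_card/fintype.subsetP => C CI; apply/imsetP.
  have /andP[_ sC] := kI _ CI.
  exists [ffun i : 'I_k => nth None (map Some (enum C)) i] => //.
  apply/finset.setP => l; rewrite inE; apply/idP/existsP => [lC|[i]]; last first.
    rewrite ffunE; have [iC|iC] := ltnP i (size (enum C)).
      by rewrite (nth_map l) // => /eqP[<-]; rewrite -mem_enum mem_nth.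
    by rewrite nth_default ?size_map.
  have ik : index l (enum C) < k.
    by apply: leq_trans sC; rewrite cardE index_mem mem_enum.
  exists (Ordinal ik); rewrite ffunE (nth_map l) ?index_mem ?mem_enum //.
  by rewrite nth_index // mem_enum.
apply: leq_trans (leq_imset_card _ _) _.
by rewrite cardsT card_ffun card_option card_prod card_bool !card_ord.
Qed.

Lemma esize_cnf k n (F : cnf) : well_formed k n F ->
  esize (n, F) <= n.*2 + size F * (k * (n.*2 + 6)).+2 + 3.
Proof.
case/andP=> wF _; rewrite esize_pair esize_nat.
apply: leq_trans (_ : (n.*2.+1 + (size F * (k * (n.*2 + 6)).+2).+1).+1 <= _); last by lia.
rewrite ltnS leq_add2l; apply: esize_seq.
apply: sub_all wF => C /and3P[_ /andP[_ sC] bC].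
apply: leq_trans (esize_seq (M := n.*2 + 5) _) _.
  apply: sub_all bC => -[b y] /= yn; rewrite esize_pair esize_nat.
  by have := esize_bool b; lia.
by rewrite ltnS -addnS leq_mul.
Qed.

Lemma bits_nth n (s : seq bool) : size s = n ->
  exists a : assignment n, bits a = s.
Proof.
move=> sn; exists [ffun i => nth false s (val i)].
apply: (@eq_from_nth _ false) => [|i]; first by rewrite size_map size_enum_ord sn.
rewrite size_map size_enum_ord => ln.
by rewrite -[i]/(nat_of_ord (Ordinal ln)) nth_bits ffunE.
Qed.

(** * The reduction as a single program *)

Section Reduction.
Variables (k b : nat) (w : seq nat).

Lemma esize_instance : exists d, forall n F, well_formed k n F ->
  size F <= (n * 2).+1 ^ k -> esize (n, F) <= n.*2.+2 ^ d.
Proof.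
have bn c : pbound (fun n : nat => n.*2 + c).
  apply: pboundD (pbound_const c); apply: pbound_le pbound_size => n.
  by rewrite esize_nat.
have : pbound (fun n : nat => n.*2 + (n * 2).+1 ^ k * (k * (n.*2 + 6)).+2 + 3).
  apply: pboundD (pbound_const 3); apply: pboundD.
    by apply: pbound_le (bn 0) => n; rewrite addn0.
  apply: pboundM; last by do 2 apply: pboundS; apply: pboundM => //; exact: pbound_const.
  apply: pboundX; apply: pbound_le (bn 1) => n; lia.
case=> d h; exists d => n F wF sF; have := h n; rewrite esize_nat; apply: leq_trans.
by apply: leq_trans (esize_cnf wF) _; rewrite leq_add2r leq_add2l leq_mul2r sF orbT.
Qed.

(** Collects what turns an exact answer for the subproblem [J] into an approximate one for [I]. The
    overhead depends on [n] alone, because a [k_instance] has polynomially many clauses. *)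
Lemma reduction p : exists q d, forall n (I : instance n) x,
  k_instance k I -> encodes I x -> exists F,
  [/\ well_formed k n F,
      forall i, num_clauses I i = count (fun C => size C == i) F &
      let vs := core w b (n, F) in
      let r := count (fun C => ~~ inside vs C) F in
      exists J : instance (size vs), exists y,
      [/\ k_instance k J, encodes J y, nae_opt I <= nae_opt J + r,
          sumn [seq weight k (size C) | C <- F & inside vs C] <= 2 ^ k * nae_opt J &
          forall a t, run p y (enc_assignment a) t -> exists a' t',
          [/\ run q x (enc_assignment a') t', t' <= t + n.*2.+2 ^ d &
              2 * nae_value J a + r <= 2 * nae_value I a']]].
Proof.
have [_ [q1 [T1 [[d1 bT1] cT1]]]] := polytime_subproblem w b.
have [_ [q2 [T2 [[d2 bT2] cT2]]]] := polytime_solution w b.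
have [e he] := esize_instance.
(* The input is kept beside the answer of [p], since [q2] needs both the instance and the values on
   the core. *)
exists (PSeq (PNode PId (PSeq q1 p)) q2).
(* The instance has size at most $(2n+2)^e$ and an assignment of the core at most $4n+1$; the
   summands bound the times of [q1] and [q2], and 20 covers the instructions that join the
   programs. *)
have [d hd] : pbound (fun n : nat => (n.*2.+2 ^ e).+1 ^ d1 +
    (n.*2.+2 ^ e + (n * 4 + 2)).+2 ^ d2 + 20).
  have bn c m : pbound (fun n : nat => n * m + c).
    apply: pboundD (pbound_const c); apply: pboundM (pbound_const m).
    by apply: pbound_le pbound_size => n; rewrite esize_nat; lia.
  have be : pbound (fun n : nat => n.*2.+2 ^ e).
    by apply: pboundX; apply: pbound_le (bn 2 2) => n; lia.
  apply: pboundD (pbound_const 20); apply: pboundD; first exact/pboundX/pboundS.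
  by apply/pboundX/pboundS/pboundS/pboundD.
exists d => n I x kI Ix; have [s /= [wF xE pI IE]] := encodes_code kI Ix.
set F := [seq map code C | C <- s] in wF xE IE; exists F; split=> //.
  move=> i; rewrite /num_clauses /F count_map.
  have -> : [set C in I | #|C| == i] =
      [set C in [seq C : clause n <- enum I | #|C| == i]].
    by apply/finset.setP => C; rewrite !inE mem_filter mem_enum andbC.
  have ue := filter_uniq (fun C : clause n => #|C| == i) (enum_uniq (mem I)).
  rewrite cardsE (card_uniqP ue) size_filter.
  rewrite -(permP pI) count_map; apply: eq_in_count => C Cs /=.
  have /map_uniq uC : uniq (map code C).
    have /andP[/allP /(_ (map code C)) + _] := wF.
    by rewrite map_f // => /(_ erefl) /and3P[].
  by rewrite cardsE (card_uniqP uC) size_map.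
have sFI : size F <= (n * 2).+1 ^ k.
  rewrite size_map -(size_map (fun C : seq (literal n) => [set l in C]) s) (perm_size pI) -cardE.
  exact: card_k_instance kI.
set vs := core w b (n, F); set r := count _ F; have wR := well_formed_restrict vs wF.
have [J [kJ Jy JE]] := code_encodes wR.
exists J, (enc (size vs, restrict F vs)); split=> //.
- apply/bigmax_leqP => a _; rewrite IE.
  apply: leq_trans (value_le_restrict F vs (nth false (bits a))) _.
  by rewrite leq_add2r; exact: (value_le_opt wR).
- have [a ha] := average_value wR.
  have -> : [seq weight k (size C) | C <- F & inside vs C] =
      [seq weight k (size C) | C <- restrict F vs].
    by rewrite /restrict -[RHS]map_comp; apply: eq_map => C /=; rewrite size_map.
  apply: leq_trans ha _; rewrite leq_mul2l; apply/orP; right.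
  by rewrite -JE; exact: leq_bigmax.
move=> a t ra.
have [t1 r1 h1] := cT1 (n, F); have [t2 r2 h2] := cT2 ((n, F), bits a).
have [a' a'E] : exists a' : assignment n, bits a' = solution w b (n, F) (bits a).
  by apply: bits_nth; rewrite size_map size_iota.
exists a', ((1 + (t1 + t).+1).+1 + t2).+1; split.
- rewrite -[enc_assignment a']/(enc (bits a')) a'E xE.
  by apply: RunSeq r2; apply: RunNode (RunId _) (RunSeq r1 ra).
- have eF := he n F wF sFI.
  have ea : esize (bits a) <= n * 4 + 1.
    apply: leq_trans (esize_seq (M := 3) _) _; first by apply/allP => c _; exact: esize_bool.
    rewrite size_map size_enum_ord.
    have [uv sv _ _] := core_spec w b (well_formed_size wF) (well_formed_vars wF).
    have : size vs <= n by rewrite -(size_iota 0 n) uniq_leq_size.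
    by lia.
  have := hd n; rewrite esize_nat.
  have : T1 (n, F) <= (n.*2.+2 ^ e).+1 ^ d1.
    by apply: leq_trans (bT1 _) _; case: (d1) => // d'; rewrite leq_exp2r.
  have : T2 ((n, F), bits a) <= (n.*2.+2 ^ e + (n * 4 + 2)).+2 ^ d2.
    apply: leq_trans (bT2 _) _; rewrite esize_pair; case: (d2) => // d'.
    by rewrite leq_exp2r //; lia.
  by lia.
rewrite JE IE a'E value_restrict; apply: value_complete.
- exact: well_formed_proper wF.
- exact: consistent_lits.
- by move=> y; exact: known_lits.
- exact: well_formed_vars wF.
Qed.

End Reduction.

(** * The stopping rule *)

(** As a function of the length, [xi'] is the chord of the concave function $1 - 2^{1-i}$ through $i
    = 2$ and $i = k$, so it lies below. Denominators are cleared and subtractions moved across. *)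
Lemma weight_chord k i : (2 < k)%N -> (2 <= i <= k)%N ->
  (2 ^ k.-1 * (i + k) + 4 <= weight k i * (k - 2) + 2 * i + 4 * 2 ^ k.-1)%N.
Proof.
move=> k3 /andP[i2 ik]; have [j iE] : exists j, i = j.+2 by exists (i - 2)%N; lia.
have [p kE] : exists p, k = (j + p).+2 by exists (k - i)%N; lia.
subst i k; rewrite /weight /= !subSS subn0.
have -> : ((j + p).+1 - j = p.+1)%N by lia.
rewrite !expnS expnD; set P := (2 ^ p)%N; set A := (2 ^ j)%N.
have hA : (j < A)%N by exact: ltn_expl.
have h1 : (P <= P * p + 1)%N by case: (p) @P => [|q] P; nia.
(* After substitution the claim is equivalent to this inequality. *)
have h2 : (P * (j + p) <= A * P * p + j)%N.
  have : (P * j <= j * P * p + j)%N by nia.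
  have : ((j + 1) * (P * p) <= A * (P * p))%N by rewrite leq_mul2r; lia.
  lia.
have h3 : (P <= A * P)%N by nia.
have -> : ((2 * (2 * (A * P)) - 2 * P) * (j + p) =
   2 * (2 * (A * P)) * (j + p) - 2 * P * (j + p))%N by rewrite mulnBl.
nia.
Qed.

(** The gap of 2 is the slack $2^{1-k}$ per lost clause that later pays for the rounding. *)
Lemma weight_le k i : (0 < k)%N -> (i <= k)%N -> (weight k i + 2 <= 2 ^ k)%N.
Proof.
move=> k0 ik; have : (2 ^ 1 <= 2 ^ (k.+1 - i))%N by rewrite leq_exp2l //; lia.
have : (2 ^ 1 <= 2 ^ k)%N by rewrite leq_exp2l.
by rewrite /weight; lia.
Qed.

Lemma weight_ge k i : (2 <= i <= k)%N -> (2 ^ k <= 2 * weight k i)%N.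
Proof.
move=> /andP[i2 ik]; have [q kE] : exists q, k = q.+1 by exists k.-1; lia.
rewrite /weight kE expnS.
have : (2 ^ (q.+2 - i) <= 2 ^ q)%N by rewrite leq_exp2l //; lia.
lia.
Qed.

Local Open Scope ring_scope.

(** * Running time *)

Section Sublinear.
Variable R : realType.
Implicit Types f g : nat -> R.

Definition sublinear f :=
  forall e : R, 0 < e -> exists N, forall n, (N <= n)%N -> `|f n| <= e * n%:R.

Lemma sublinearP f :
  (f =o_\oo (fun n => n%:R : R))%classic <-> sublinear f.
Proof.
rewrite eqoP; split=> fo e e0.
  have [N _ fN] := fo e e0; exists N => n Nn; have := fN n Nn => /=.
  by rewrite (ger0_norm (ler0n _ _)).
have [N fN] := fo e e0; exists N => // n Nn /=.
by rewrite (ger0_norm (ler0n _ _)); exact: fN.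
Qed.

Lemma sublinearD f g : sublinear f -> sublinear g ->
  sublinear (fun n => f n + g n).
Proof.
move=> fo go e e0; have e2 : 0 < e / 2 by lra.
have [N fN] := fo _ e2; have [M gM] := go _ e2.
exists (maxn N M) => n; rewrite geq_max => /andP[/fN hf /gM hg].
by apply: le_trans (ler_normD _ _) _; lra.
Qed.

Lemma sublinearZ c f : sublinear f -> sublinear (fun n => c * f n).
Proof.
move=> fo e e0; have c0 := normr_ge0 c.
have e1 : 0 < e / (`|c| + 1) by apply: divr_gt0 => //; lra.
have [N fN] := fo _ e1; exists N => n /fN; rewrite normrM mulrAC.
rewrite ler_pdivlMr; last by lra.
by have := normr_ge0 (f n); nra.
Qed.

Lemma sublinear_const c : sublinear (fun=> c).
Proof.
move=> e e0; exists (Num.bound (`|c| / e)) => n Nn.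
rewrite mulrC -ler_pdivrMr //; apply: le_trans (ltW (archi_boundP _)) _.
  by rewrite divr_ge0 // ltW.
by rewrite ler_nat.
Qed.

(** With $y = 2n+2$ one has $\ln y = 2 \ln \sqrt{y} \le 2 \sqrt{y}$, and $4y \le 16n \le e^2 n^2$
    once $n \ge 1$ and $n \ge 16/e^2$. *)
Lemma sublinear_ln : sublinear (fun n => ln (n.*2.+2)%:R).
Proof.
move=> e e0; exists (Num.bound (16 / e ^+ 2)).+1 => n Nn.
have n1 : 1 <= n%:R :> R by rewrite ler1n (leq_trans _ Nn).
have nE : (n.*2.+2)%:R = 2 * n%:R + 2 :> R by rewrite -addn2 natrD -muln2 natrM; lra.
have ne : 16 <= e ^+ 2 * n%:R.
  rewrite mulrC -ler_pdivrMr ?exprn_gt0 //.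
  apply: le_trans (ltW (archi_boundP _)) _; first by rewrite divr_ge0 // exprn_ge0 // ltW.
  by rewrite ler_nat ltnW.
have y0 : 0 < (n.*2.+2)%:R :> R by rewrite ltr0n.
rewrite ger0_norm; last by rewrite ln_ge0 // ler1n.
rewrite -(sqr_sqrtr (ltW y0)) lnXn ?sqrtr_gt0 //.
have := ln_sublinear (_ : 0 < Num.sqrt (n.*2.+2)%:R :> R).
rewrite sqrtr_gt0 y0 => /(_ erefl) /ltW h.
have s0 := sqrtr_ge0 ((n.*2.+2)%:R : R).
have en : 0 <= e * n%:R by apply: mulr_ge0; [exact: ltW | lra].
suff : 2 * Num.sqrt (n.*2.+2)%:R <= e * n%:R.
  by move=> h2; apply: le_trans h2; rewrite -[leLHS]mulr_natl; apply: ler_wpM2l.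
rewrite -(ler_pXn2r (_ : 0 < 2)%N) ?nnegrE //.
rewrite exprMn sqr_sqrtr; last exact: ltW.
rewrite nE exprMn.
have := ler_wpM2r (le_trans ler01 n1) ne.
by move: (n%:R : R) n1 {ne nE en} => x x1 h3; lra.
Qed.

(** The exact program runs on some number $s \le n$ of variables and [f] need not be monotone; the
    running maximum bounds $f(s)$ in terms of $n$. Early terms contribute a constant, later ones at
    most $e j \le e n$. *)
Lemma sublinear_max f : sublinear f ->
  sublinear (fun n => \big[Num.max/0]_(j < n.+1) `|f j|).
Proof.
move=> fo e e0; have [N fN] := fo e e0.
pose B := \big[Num.max/0]_(j < N.+1) `|f j|.
have [M cM] := sublinear_const B e0.
exists (maxn N M) => n; rewrite geq_max => /andP[Nn Mn].
have en : 0 <= e * n%:R by apply: mulr_ge0; [exact: ltW | exact: ler0n].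
rewrite ger0_norm; last first.
  by apply: le_trans (normr_ge0 (f 0%N)) _; exact: (le_bigmax _ _ (@ord0 n)).
apply: bigmax_le => // j _; have [jN|jN] := leqP N j.
  apply: le_trans (fN _ jN) _; rewrite ler_wpM2l ?(ltW e0) // ler_nat.
  by rewrite -ltnS.
apply: le_trans (le_trans (ler_norm B) (cM _ Mn)).
exact: (le_bigmax _ (fun j : 'I_N.+1 => `|f j|) (Ordinal (ltnW jN : (j < N.+1)%N))).
Qed.

End Sublinear.

(** * Average length, total weight and the rounded stopping test *)

Lemma sum_count_size k (F : cnf) (c : nat -> nat) :
  all (fun C => (size C <= k)%N) F ->
  (\sum_(i < k.+1) c i * count (fun C => size C == i) F)%N =
  sumn [seq c (size C) | C <- F].
Proof.
elim: F => [_|C F IHF /= /andP[sC /IHF <-]].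
  by rewrite big1 // => i _; rewrite muln0.
rewrite (eq_bigr (fun i : 'I_k.+1 => (c i * (size C == i)) + c i * count (fun D => size D == i) F)%N); last first.
  by move=> i _; rewrite -mulnDr.
rewrite big_split /=; congr addn.
rewrite (bigD1 (Ordinal (sC : (size C < k.+1)%N))) //= eqxx muln1 big1 ?addn0 // => i ik.
have /negPf -> : size C != i by apply: contra_neq ik => sE; exact/val_inj.
by rewrite muln0.
Qed.

Lemma avg_length_cnf (R : realType) k n (I : instance n) (F : cnf) :
  well_formed k n F ->
  (forall i, num_clauses I i = count (fun C => size C == i) F) ->
  avg_length R k I = (sumn [seq size C | C <- F])%:R / (size F)%:R.
Proof.
move=> /well_formed_size sF IE; rewrite /avg_length; congr (_%:R / _%:R).
  by under eq_bigr do rewrite IE; exact: (sum_count_size id).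
under eq_bigr do rewrite IE -[count _ _]mul1n.
rewrite (sum_count_size (fun=> 1%N)) //; elim: (F) => //= C G ->.
by rewrite add1n.
Qed.

(** By [weight_le] each lost clause weighs at most $2^k - 2$. *)
Lemma total_filter k (P : pred (seq lit)) (F : cnf) : (0 < k)%N ->
  all (fun C => size C <= k)%N F ->
  (sumn [seq weight k (size C) | C <- F] + 2 * count (fun C => ~~ P C) F <=
   sumn [seq weight k (size C) | C <- F & P C] +
     count (fun C => ~~ P C) F * 2 ^ k)%N.
Proof.
move=> k0; elim: F => //= C F IHF /andP[/(weight_le k0) hC /IHF {IHF}].
case: (P C) => /=; rewrite ?add0n; first by rewrite -!addnA leq_add2l.
by rewrite mulnDr mulnDl mul1n => hF; have := leq_add hC hF; rewrite addnACA muln1 [leqRHS]addnCA.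
Qed.

Section Weights.
Variables (R : realType) (k n : nat) (F : cnf).
Hypotheses (k2 : (2 <= k)%N) (wF : well_formed k n F).

Let sizes C : C \in F -> (2 <= size C <= k)%N.
Proof. by case/andP: wF => /allP wC _ /wC /and3P[]. Qed.

Notation total G := (sumn [seq weight k (size C) | C <- G]).

(** The chord is affine, so its sum over the clauses depends only on their number and total length,
    that is, on the average length. For $k = 2$ every clause has weight 2. *)
Lemma xi_weight :
  xi' k ((sumn [seq size C | C <- F])%:R / (size F)%:R) * (size F)%:R <=
  (total F)%:R / 2 ^+ k :> R.
Proof.
have [F0|m0] := posnP (size F).
  by rewrite F0 mulr0 divr_ge0 ?ler0n ?exprn_ge0.
rewrite /xi'; case: eqP => [kE|/eqP kn2].
  suff : (size F * 2 <= total F)%N.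
    by rewrite kE -(ler_nat R) natrM; lra.
  move: sizes; rewrite kE {kE m0}; elim: (F) => // C G IHG sG.
  have /andP[s2 s2'] := sG C (mem_head _ _).
  have sE : size C = 2%N by apply/eqP; rewrite eqn_leq s2 s2'.
  have := IHG (fun D DG => sG D (mem_behead (s := C :: G) DG)).
  by rewrite /= sE -[weight 2 2]/2%N; lia.
have k3 : (2 < k)%N by rewrite ltn_neqAle eq_sym kn2.
set L := sumn [seq size C | C <- F].
have chord : (2 ^ k.-1 * (L + k * size F) + 4 * size F <=
    total F * (k - 2) + 2 * L + 4 * 2 ^ k.-1 * size F)%N.
  move: sizes; rewrite /L; elim: (F) => [_|C G IHG sG]; first by rewrite /= !muln0.
  have := IHG (fun D DG => sG D (mem_behead (s := C :: G) DG)).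
  have := weight_chord k3 (sG C (mem_head _ _)).
  rewrite /=; nia.
have m1 : (size F)%:R != 0 :> R by rewrite pnatr_eq0 -lt0n.
have k20 : 0 < k%:R - 2 :> R by rewrite subr_gt0 ltr_nat.
set x := L%:R / (size F)%:R; have xE : x * (size F)%:R = L%:R :> R.
  by rewrite /x divfK.
have E (a b c d : R) : a / (b * c) * d = a * d / c / b by rewrite invfM; lra.
rewrite E ler_pM2r ?invr_gt0 ?exprn_gt0 // ler_pdivrMr //.
move: chord; rewrite -(ler_nat R) !(natrD, natrM, natrX) natrB ?(ltnW k3) // -xE.
lra.
Qed.

Variables (delta : R).
Hypothesis hd : 0 < delta < 1.

Let beta : R := 1 - delta.
(** Scale of the rounding, a function of [k] and [delta] only. Rounding errors add up to at most one
    per clause, while the unscaled test has slack at least $2 \beta^2 2^{-k}$ per clause. *)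
Let N : R := (Num.bound (2 ^+ k / beta ^+ 2))%:R.

Let beta_gt0 : 0 < beta.
Proof. by rewrite subr_gt0; case/andP: hd. Qed.

Let pow_gt0 : 0 < 2 ^+ k :> R. Proof. exact: exprn_gt0. Qed.

Let N_ge : 2 ^+ k <= N * beta ^+ 2.
Proof.
rewrite -ler_pdivrMr ?exprn_gt0 //; apply/ltW/archi_boundP.
by rewrite divr_ge0 // exprn_ge0 // ltW.
Qed.

Let N_gt0 : 0 < N.
Proof.
have b2 : 0 < beta ^+ 2 by exact: exprn_gt0.
by rewrite -(pmulr_lgt0 _ b2); apply: lt_le_trans N_ge.
Qed.

(* Integer approximations of the coefficients in the condition
   (delta - 1/2) r <= (1 - delta) W, where W is the expected value of a random
   assignment on the kept clauses and r counts the others. *)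
Definition table : seq nat :=
  mkseq (fun i => Num.truncn (N * beta * ((weight k i)%:R / 2 ^+ k))) k.+1.

(** Rounded up where [table] is rounded down, so that the integer test implies the real one. For
    $\delta \le 1/2$ the real condition always holds. *)
Definition coeff : nat :=
  if delta <= 2^-1 then 0%N else (Num.truncn (N * (delta - 2^-1))).+1.

Let rounded (C : seq lit) : C \in F ->
  (nth 0%N table (size C))%:R <= N * beta * ((weight k (size C))%:R / 2 ^+ k) <=
  (nth 0%N table (size C))%:R + 1.
Proof.
move=> CF; have /andP[_ sC] := sizes CF; rewrite nth_mkseq ?ltnS //.
have x0 : 0 <= N * beta * ((weight k (size C))%:R / 2 ^+ k).
  by rewrite !mulr_ge0 ?invr_ge0 ?ler0n // ltW.
by have /andP[h1 h2] := truncn_itv x0; rewrite h1 natr1 ltW.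
Qed.

Let rounded_sum (G : cnf) : {subset G <= F} ->
  (sumn [seq nth 0%N table (size C) | C <- G])%:R <=
  N * beta * ((total G)%:R / 2 ^+ k) <=
  (sumn [seq nth 0%N table (size C) | C <- G])%:R + (size G)%:R.
Proof.
elim: G => [_|C G IHG sG]; first by rewrite /= mul0r mulr0 addr0 lexx.
have /IHG : {subset G <= F} by move=> D DG; apply: sG; rewrite inE DG orbT.
have := rounded (sG C (mem_head _ _)).
rewrite /= -[(size G).+1]add1n !natrD mulrDl mulrDr.
by move=> /andP[h1 h2] /andP[h3 h4]; apply/andP; split; lra.
Qed.

(** Soundness of the test: rounding only makes it stricter, and [o], later the optimum of the
    subproblem, dominates $W_S$. *)
Lemma affordable_bound vs (o : nat) : affordable table coeff F vs ->
  (total [seq C <- F | inside vs C] <= 2 ^ k * o)%N ->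
  (delta - 2^-1) * (count (fun C => ~~ inside vs C) F)%:R <= (1 - delta) * o%:R.
Proof.
rewrite /affordable; set G := [seq C <- F | inside vs C]; set r := count _ F.
have GF : {subset G <= F} by move=> C; rewrite mem_filter => /andP[].
move: (rounded_sum GF) => /andP[h _]; rewrite -(ler_nat R) natrM => aff.
rewrite -(ler_nat R) natrM natrX => tot.
have r0 : 0 <= r%:R :> R by exact: ler0n.
have o0 : 0 <= o%:R :> R by exact: ler0n.
have [d2|d2] := leP delta 2^-1; first by have b0 : 0 < 1 - delta := beta_gt0; nra.
rewrite -(ler_pM2l N_gt0) !mulrA.
have tot' : (total G)%:R / 2 ^+ k <= o%:R :> R by rewrite ler_pdivrMr // mulrC.
have h' : N * beta * ((total G)%:R / 2 ^+ k) <= N * beta * o%:R.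
  by rewrite ler_wpM2l // mulr_ge0 // ltW.
apply: le_trans (le_trans aff (le_trans h h')); rewrite ler_wpM2r //.
rewrite /coeff (lt_geF d2) ltW //.
have x0 : 0 <= N * (delta - 2^-1) by rewrite mulr_ge0 ?ltW // subr_gt0.
by have /andP[] := truncn_itv x0.
Qed.

(** Completeness of the test: a list losing few clauses passes despite the rounding. Read
    contrapositively, it says that the first rejected list has lost many clauses. *)
Lemma affordable_small (X : R) vs : X <= (total F)%:R / 2 ^+ k ->
  (count (fun C => ~~ inside vs C) F)%:R <= 2 * (1 - delta) * X ->
  affordable table coeff F vs.
Proof.
rewrite -/beta => XF rX; rewrite /affordable; set G := [seq C <- F | inside vs C].
move: rX; set r := count _ F => rX.
have [d2|d2] := leP delta 2^-1; first by rewrite /coeff d2 mul0n.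
have GF : {subset G <= F} by move=> C; rewrite mem_filter => /andP[].
move: (rounded_sum GF) => /andP[_ h].
have x0 : 0 <= N * (delta - 2^-1) by rewrite mulr_ge0 ?ltW // subr_gt0.
have hb : coeff%:R <= N * (delta - 2^-1) + 1.
  rewrite /coeff (lt_geF d2) -[leLHS]natr1 lerD2r.
  by have /andP[] := truncn_itv x0.
have mE : (size F)%:R = (size G)%:R + r%:R :> R.
  by rewrite -natrD /G size_filter /r -(count_predC (inside vs) F).
have half : (size F)%:R <= 2 * ((total F)%:R / 2 ^+ k) :> R.
  suff : (size F * 2 ^ k <= 2 * total F)%N.
    by rewrite -(ler_nat R) !(natrM, natrX) mulrA ler_pdivlMr.
  move: sizes; elim: (F) => //= C H IHH sH.
  have := weight_ge (sH C (mem_head _ _)).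
  have := IHH (fun D DH => sH D (mem_behead (s := C :: H) DH)); lia.
have drop : (total F)%:R / 2 ^+ k + 2 * r%:R / 2 ^+ k <= (total G)%:R / 2 ^+ k + r%:R :> R.
  rewrite -(ler_pM2r pow_gt0) [leLHS]mulrDl [leRHS]mulrDl !divfK ?gt_eqF //.
  suff : (total F + 2 * r <= total G + r * 2 ^ k)%N.
    by rewrite -(ler_nat R) [leLHS]natrD [leRHS]natrD !natrM natrX.
  by apply: total_filter (ltnW k2) _; exact: well_formed_size wF.
rewrite -(ler_nat R) natrM.
have r0 : 0 <= r%:R :> R by exact: ler0n.
have b0 := beta_gt0; have b1 : beta <= 2^-1 by rewrite /beta; lra.
have PN := N_ge; have P0 := pow_gt0.
have p4 : 4 <= 2 ^+ k :> R by rewrite -natrX (ler_nat R 4) (leq_exp2l 2 k (isT : (1 < 2)%N)).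
set P : R := 2 ^+ k in P0 PN h half drop XF p4 *.
set u := (total G)%:R / P in h drop *; set v := (total F)%:R / P in half drop XF.
(* Rounding costs at most 1 for each kept clause by [h] and at most 1 for each lost clause by [hb],
   hence [size F] in total. *)
suff key : (size F)%:R <= N * (beta * u - (delta - 2^-1) * r%:R).
  have := ler_wpM2r r0 hb; lra.
have q1 : P^-1 * P = 1 by rewrite mulVf // gt_eqF.
have Q0 : 0 < P^-1 by rewrite invr_gt0.
have Q4 : P^-1 <= 4^-1 by rewrite lef_pV2 ?posrE.
set Q := P^-1 in q1 drop Q0 Q4 *.
have rv : r%:R <= 2 * beta * v.
  by apply: le_trans rX _; rewrite ler_wpM2l // mulr_ge0 // ltW.
have m0 : 0 <= (size F)%:R :> R by exact: ler0n.
(* By [drop] the right side is at least $\beta v - (1/2 - 2 \beta Q) r$. Then $r \le 2 \beta v$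
   leaves $4 \beta^2 Q v$, and [half] concludes. *)
have bound : 2 * beta ^+ 2 * Q * (size F)%:R <= beta * u - (delta - 2^-1) * r%:R.
  have c0 : 0 <= 2^-1 - 2 * beta * Q by nra.
  have h1 : beta * (v + 2 * r%:R * Q - r%:R) <= beta * u by apply: ler_wpM2l; lra.
  have h2 := ler_wpM2r c0 rv.
  have h3 : 0 <= beta ^+ 2 * Q by rewrite mulr_ge0 // ?exprn_ge0 // ltW.
  have h4 := ler_wpM2l h3 half.
  by rewrite /beta in h1 h2 h4 *; lra.
apply: le_trans (ler_wpM2l (ltW N_gt0) bound).
have := ler_wpM2r (mulr_ge0 (ltW Q0) m0) PN.
by rewrite mulrA [P * Q]mulrC q1; lra.
Qed.

End Weights.

(** * The size of the core and the final time bound *)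

Lemma ffact_le k m : (m ^_ k <= m ^ k)%N.
Proof.
rewrite ffact_prod -[in leqRHS](card_ord k) -prod_nat_const.
by apply: leq_prod => i _; exact: leq_subr.
Qed.

Lemma ffact_ge k m : ((m - k) ^ k <= m ^_ k)%N.
Proof.
rewrite ffact_prod -[X in (_ ^ X)%N](card_ord k) -prod_nat_const.
by apply: leq_prod => i _; apply: leq_sub2l; exact: ltnW.
Qed.

(** Bounding the falling factorials below by $(s-1-k)^k$ and above by $n^k$ and taking roots gives
    $s-1-k \le n g^{1/k}$. The additive $k+1$ costs only a constant factor of time. *)
Lemma core_size (R : realType) k n m c s (g : R) : (0 < k)%N -> (0 < m)%N ->
  (m * s.-1 ^_ k <= c * n ^_ k)%N -> c%:R <= g * m%:R ->
  s%:R <= n%:R * Num.max 0 g `^ k%:R^-1 + k.+1%:R.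
Proof.
move=> k0 m0 H cg; set a := _ `^ _.
have a0 : 0 <= a by exact: powR_ge0.
have mx0 : 0 <= Num.max 0 g by rewrite le_max lexx.
have ak : a ^+ k = Num.max 0 g.
  by rewrite -powR_mulrn // -powRrM mulVf ?powRr1 // pnatr_eq0 -lt0n.
rewrite leNgt; apply/negP => big.
have ks : (k.+1 <= s)%N.
  rewrite -(ler_nat R); apply: le_trans (ltW big).
  by rewrite lerDr mulr_ge0.
have big' : n%:R * a < (s.-1 - k)%:R.
  have -> : (s.-1 - k = s - k.+1)%N by lia.
  by rewrite natrB // ltrBrDr.
have h1 : (n%:R * a) ^+ k < ((s.-1 - k) ^ k)%:R.
  by rewrite natrX ltr_pXn2r // nnegrE // mulr_ge0.
have m0' : 0 < m%:R :> R by rewrite ltr0n.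
have : m%:R * ((s.-1 - k) ^ k)%:R <= c%:R * (n ^_ k)%:R :> R.
  rewrite -!natrM ler_nat; apply: leq_trans H.
  by rewrite leq_mul2l ffact_ge orbT.
apply/negP; rewrite -ltNge.
apply: le_lt_trans (_ : m%:R * (n%:R * a) ^+ k < _); last by rewrite ltr_pM2l.
have gM : g <= Num.max 0 g by rewrite le_max lexx orbT.
apply: le_trans (ler_wpM2r (ler0n _ _) cg) _.
rewrite exprMn ak [g * _]mulrC -mulrA ler_pM2l // mulrC.
apply: le_trans (ler_wpM2l (ler0n _ _) gM) _.
by rewrite ler_wpM2r // -natrX ler_nat ffact_le.
Qed.

Lemma powR_base_ge1 (R : realType) (c : R) (f : nat -> R) : 0 < c ->
  sublinear f -> (forall n, 1 <= 2 `^ f n * c `^ n%:R) -> 1 <= c.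
Proof.
move=> c0 fo h; rewrite leNgt; apply/negP => c1.
have lc : ln c < 0 by rewrite ln_lt0 // c0.
have l2 : 0 < ln 2 :> R by rewrite ln_gt0 // ltr1n.
(* With this margin $f(n) \ln 2$ is at most half of $-n \ln c$, so the product in [h] eventually
   drops below 1. *)
have e0 : 0 < - ln c / (2 * ln 2) by rewrite divr_gt0 ?oppr_gt0 ?mulr_gt0.
have [N fN] := fo _ e0; have := fN N.+1 (leqnSn N).
rewrite mulrAC ler_pdivlMr ?mulr_gt0 // => fl.
have := h N.+1; rewrite -ler_ln ?posrE ?mulr_gt0 ?powR_gt0 //.
rewrite ln1 lnM ?posrE ?powR_gt0 // !ln_powR => h0.
have n1 : 0 < N.+1%:R :> R by rewrite ltr0n.
have := ler_wpM2r (ltW l2) (ler_norm (f N.+1)).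
have := mulr_gt0 n1 (_ : 0 < - ln c); rewrite oppr_gt0 => /(_ lc).
set x := N.+1%:R in n1 h0 fl *; lra.
Qed.

Lemma exponent1 (R : realType) k (eta : R) n : exponent k 1 eta n = n%:R.
Proof. by rewrite /exponent subrr mulr0 mul0r subr0 max_r // powR1 mulr1. Qed.

Theorem theorem7 (R : realType) (k : nat) (c delta : R)
    (hk : (2 <= k)%N) (hc : 0 < c) (hdelta : 0 < delta <= 1)
    (hexact : exists p : prog,
       nae_algorithm k optimal (fun n (I : instance n) => c `^ n%:R) p) :
  exists p : prog,
    nae_algorithm k (approximate delta)
      (fun n (I : instance n) =>
         c `^ (exponent k delta (avg_length R k I) n)) p.
Proof.
have [p [f [/sublinearP fo hp]]] := hexact.
(* For $\delta = 1$ the scale [N] would divide by zero; here the exact program itself does the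
   job. *)
have [d1|/eqP d1] := eqVneq delta 1.
  exists p, f; split; first exact/sublinearP.
  move=> n I x kI Ix; have [a [t [ra oa ta]]] := hp n I x kI Ix.
  exists a, t; split=> //; first by rewrite /approximate d1 mul1r oa.
  by rewrite d1 exponent1.
have hd : 0 < delta < 1.
  by case/andP: hdelta => -> d2 /=; rewrite lt_neqAle d2 andbT; apply/eqP.
(* Even the empty instance costs one step, so $2^{f(n)} c^n \ge 1$ for all $n$. With $c \ge 1$ an
   upper bound on the core size becomes an upper bound on the time. *)
have c1 : 1 <= c.
  apply: powR_base_ge1 hc fo _ => n.
  have k0 : k_instance k (finset.set0 : instance n) by move=> C; rewrite inE.
  have e0 : encodes (finset.set0 : instance n) (enc (n, [::] : cnf)).
    by exists [::]; split=> //; apply/finset.setP => C; rewrite !inE.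
  have [a [t [ra _ ta]]] := hp n _ _ k0 e0.
  by apply: le_trans ta; rewrite ler1n; case: ra.
pose w := table k delta; pose b := coeff k delta.
have [q [d hq]] := reduction k b w p.
pose M n := \big[Num.max/0]_(j < n.+1) `|f j|.
have l2 : 0 < ln 2 :> R by rewrite ln_gt0 // ltr1n.
(* In order: a factor 2 for adding two times, $c^{k+1}$ for the additive term in the core size, the
   polynomial overhead, and the subexponential factor of the exact program. *)
pose g n := (1 + k.+1%:R * ln c / ln 2) + (d%:R / ln 2 * ln (n.*2.+2)%:R + M n).
exists q, g; split.
  apply/sublinearP; apply: sublinearD; first exact: sublinear_const.
  by apply: sublinearD; [exact/sublinearZ/sublinear_ln | exact: sublinear_max].
move=> n I x kI Ix; have [F [wF nF]] := hq n I x kI Ix.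
set vs := core w b (n, F) => -[J [y [kJ Jy OJ WJ hJ]]].
have [aJ [t [rJ oJ tJ]]] := hp _ _ _ kJ Jy.
have [a [t' [ra ta Va]]] := hJ _ _ rJ; exists a, t'; split=> //.
  have [uv sv av _] := core_spec w b (well_formed_size wF) (well_formed_vars wF).
  (* This gives $\delta\, OPT \le \delta (OPT_S + r) \le OPT_S + r/2$, which the recovered half of
     the lost clauses attains. *)
  have := affordable_bound wF hd av WJ; rewrite -/vs /approximate.
  move: Va OJ; rewrite oJ -/vs; set r := count _ F => Va OJ key.
  have {}Va : 2 * (nae_opt J)%:R + r%:R <= 2 * (nae_value I a)%:R :> R.
    by rewrite -!natrM -natrD ler_nat.
  have {}OJ : (nae_opt I)%:R <= (nae_opt J)%:R + r%:R :> R by rewrite -natrD ler_nat.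
  have := ler_wpM2l (ltW (andP hd).1) OJ; lra.
have sz : (size vs)%:R <= exponent k delta (avg_length R k I) n + k.+1%:R.
  have [_ _ _ [vE|[u nu cu]]] := core_spec w b (well_formed_size wF) (well_formed_vars wF).
    by rewrite /vs vE /= addr_ge0 // mulr_ge0 // powR_ge0.
  have m0 : (0 < size F)%N.
    by case: (F) nu => //; rewrite /affordable /= muln0.
  apply: core_size cu _ => //; first by rewrite ltnW.
  rewrite (avg_length_cnf R wF nF); set xi := xi' _ _.
  have := xi_weight R hk wF; rewrite -/xi => xiW.
  (* The rejected list [u] has lost more than this many clauses, so its coverage is below $(1 -
     2(1-\delta)\xi')\,m$, the input for [core_size]. *)
  have : 2 * (1 - delta) * (xi * (size F)%:R) < (count (fun C => ~~ inside u C) F)%:R.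
    by rewrite ltNge; apply/negP => /(affordable_small hk wF hd xiW); rewrite (negPf nu).
  have <- : (coverage F u + count (fun C => ~~ inside u C) F)%N = size F.
    exact: count_predC.
  rewrite natrD; lra.
have Mj j : (j < n.+1)%N -> `|f j| <= M n.
  move=> jn; exact: (le_bigmax _ (fun i : 'I_n.+1 => `|f i|) (Ordinal jn)).
have sn : (size vs < n.+1)%N.
  have [uv sv _ _] := core_spec w b (well_formed_size wF) (well_formed_vars wF).
  by rewrite ltnS -(size_iota 0 n) uniq_leq_size.
set E := exponent _ _ _ _ in sz *.
have E0 : 0 <= E by rewrite mulr_ge0 // powR_ge0.
have y0 : 0 < (n.*2.+2)%:R :> R by rewrite ltr0n.
have gE : 2 `^ g n = 2 * c `^ k.+1%:R * (n.*2.+2 ^ d)%:R * 2 `^ M n.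
  rewrite /g !powRD ?pnatr_eq0 ?implybT // powRr1 // natrX -powR_mulrn; last exact: ltW.
  rewrite /powR !pnatr_eq0 /= (gt_eqF hc) !mulrA; congr (2 * expR _ * expR _ * _).
    by rewrite divfK // gt_eqF.
  by rewrite mulrAC divfK // gt_eqF.
have M0 : 0 <= M n := le_trans (normr_ge0 _) (Mj 0%N isT).
have A1 : 1 <= 2 `^ M n by rewrite -[leLHS](powRr0 2); apply: ler_powR => //; rewrite ler1n.
have B1 : 1 <= c `^ k.+1%:R by rewrite -[leLHS](powRr0 c); apply: ler_powR.
have E1 : 1 <= c `^ E by rewrite -[leLHS](powRr0 c); apply: ler_powR.
have Q1 : 1 <= (n.*2.+2 ^ d)%:R :> R by rewrite ler1n expn_gt0.
have tE : t%:R <= 2 `^ M n * (c `^ E * c `^ k.+1%:R).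
  apply: le_trans tJ _; apply: ler_pM; rewrite ?powR_ge0 //.
    by apply: ler_powR; rewrite ?ler1n // (le_trans (ler_norm _)) // Mj.
  by rewrite -powRD ?(gt_eqF hc) ?implybT //; apply: ler_powR.
rewrite gE; apply: le_trans (_ : (t + n.*2.+2 ^ d)%:R <= _); first by rewrite ler_nat.
rewrite natrD; set Q := (n.*2.+2 ^ d)%:R in Q1 *.
set X := 2 `^ M n * (c `^ E * c `^ k.+1%:R) in tE.
have X1 : 1 <= X by rewrite !mulr_ege1.
(* Since $X$ and $Q$ are at least 1, each summand of $t + Q$ is at most $XQ$. *)
have -> : 2 * c `^ k.+1%:R * Q * 2 `^ M n * c `^ E = X * Q + X * Q by rewrite /X; lra.
apply: lerD; first by apply: le_trans tE _; rewrite ler_peMr // (le_trans ler01).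
by rewrite ler_peMl // (le_trans ler01).
Qed.
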